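(* Let $X_1,\dots,X_n$ be i.i.d. random vectors in $\mathbb{R}^p$ with mean $0$ and covariance matrix $\Sigma\neq0$, in the asymptotic regime $n\to\infty$, $p=p_n$. Let $\hat\Sigma=n^{-1}\sum_{i=1}^nX_iX_i^T$, $\hat f=(\mathrm{tr}(\hat\Sigma^2))^{1/2}$, $f=(\mathrm{tr}(\Sigma^2))^{1/2}$. (i) If $\mathbb{E}[(X_1^TX_1)^2]=o(nf^2)$, then $\mathbb{E}|\hat\Sigma/\hat f-\Sigma/f|_F^2=o(1)$, and consequently $\rho(\hat\Sigma/\hat f-\Sigma/f)=o_{\mathbb{P}}(1)$. (ii) If $nf^2=o(\mathbb{E}[(X_1^TX_1)^2])$, $K_2=O(n^{3/4})$, and $\mathbb{E}[(X_1^TX_2)^4]=o(\{\mathbb{E}[(X_1^TX_1)^2]\}^2)$, then $\rho(\hat\Sigma/\hat f)=o_{\mathbb{P}}(1)$, and $\rho(\hat\Sigma/\hat f-\Sigma/f)=o_{\mathbb{P}}(1)$ holds if and only if $\rho(\Sigma)=o(f)$.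
   Context: $|A|_F$ is the Frobenius norm and $\rho(A)$ the spectral norm of a matrix $A$. $f_1=\mathrm{tr}(\Sigma)$ and $K_2^4=\mathbb{E}|(X_1^TX_1-f_1)/f|^4$. *)

(* Defs.v *)
From HB Require Import structures.
From mathcomp Require Import all_boot all_order all_algebra.
From mathcomp Require Import all_classical all_reals all_analysis.
Set Implicit Arguments. Unset Strict Implicit. Unset Printing Implicit Defensive.
Import Order.TTheory GRing.Theory Num.Theory.
Local Open Scope ring_scope.
Local Open Scope classical_set_scope.

Section Defs.
Context {R : realType}.

Definition vnorm (p : nat) (v : 'cV[R]_p) : R := Num.sqrt (\sum_(j < p) v j ord0 ^+ 2).

Definition frob2 (p q : nat) (A : 'M[R]_(p, q)) : R := \sum_(i < p) \sum_(j < q) A i j ^+ 2.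

Definition spec_norm (p q : nat) (A : 'M[R]_(p, q)) : R :=
  sup [set x | exists v : 'cV[R]_q, vnorm v <= 1 /\ x = vnorm (A *m v)].

(** sigma-algebra on R^p generated by the coordinate maps (Borel sigma-algebra) *)
Definition cV_sigma (p : nat) : set (set 'cV[R]_p) :=
  <<s [set C | exists (j : 'I_p) (B : set R), measurable B /\
                C = (fun v : 'cV[R]_p => v j ord0) @^-1` B] >>.

Section Model.
Context {d : measure_display} {T : measurableType d} (P : probability T R).

Definition indep_vectors (n p : nat) (X : nat -> T -> 'cV[R]_p) : Prop :=
  forall C : nat -> set 'cV[R]_p, (forall i, (i < n)%N -> cV_sigma (C i)) ->
    P (\bigcap_(i < n) (X i @^-1` C i)) = (\prod_(i < n) P (X i @^-1` C i))%E.

Definition ident_distr (n p : nat) (X : nat -> T -> 'cV[R]_p) : Prop :=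
  forall i k C, (i < n)%N -> (k < n)%N -> cV_sigma C ->
    P (X i @^-1` C) = P (X k @^-1` C).

Definition iid_mean0_cov (n p : nat) (X : nat -> T -> 'cV[R]_p) (Sigma : 'M[R]_p) : Prop :=
  (forall i (j : 'I_p), (i < n)%N -> measurable_fun setT (fun w => X i w j ord0)) /\
  (      forall i (j : 'I_p), (i < n)%N ->
        P.-integrable setT (fun w => ((X i w j ord0) ^+ 2)%:E)) /\
  (      forall i (j : 'I_p), (i < n)%N -> ('E_P[fun w => X i w j ord0] = 0)%E) /\
  (      forall i (j k : 'I_p), (i < n)%N ->
        ('E_P[fun w => (X i w j ord0 * X i w k ord0)%R] = (Sigma j k)%:E)%E) /\
        indep_vectors n X /\ ident_distr n X.

End Model.

Definition sample_cov (T : Type) (n p : nat) (X : nat -> T -> 'cV[R]_p) (w : T) : 'M[R]_p :=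
  n%:R^-1 *: \sum_(i < n) (X i w *m (X i w)^T).

Definition fnorm (p : nat) (A : 'M[R]_p) : R := Num.sqrt (\tr (A *m A)).

Definition little_o (u v : nat -> R) : Prop :=
  forall eps : R, 0 < eps -> \forall n \near \oo, `|u n| <= eps * `|v n|.

Definition o_P1 (d : measure_display) (T : nat -> measurableType d)
  (P : forall n, probability (T n) R) (Y : forall n, T n -> R) : Prop :=
  forall eps delta : R, 0 < eps -> 0 < delta ->
    \forall n \near \oo, (P n [set w | (eps < `|Y n w|)%R] <= delta%:E)%E.

End Defs.

(* Main.v *)
Require Import Defs.
From HB Require Import structures.
From mathcomp Require Import all_boot all_order all_algebra.
From mathcomp Require Import all_classical all_reals all_analysis.
From mathcomp Require Import measurable_realfun ring lra.
Import Order.TTheory GRing.Theory Num.Theory.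
Import numFieldNormedType.Exports.
Local Open Scope ring_scope.
Local Open Scope classical_set_scope.

(** Write [S] for the sample covariance matrix, [f] for the Frobenius norm of
    [Sigma] and [M = E |X_1|^4].  For (i), the entries of [S - Sigma] are
    averages of centred independent variables, so [E |S - Sigma|_F^2 <= M / n],
    and normalising changes a distance by at most the factor [2 / f].

    For (ii), let [G i k] be the inner product of [X_i] and [X_k].  Then
    [n rho(S)] is at most the largest diagonal entry of the Gram matrix [G]
    plus the Frobenius norm of its off-diagonal part, while
    [n^2 fhat^2 >= sum_i (G i i)^2].  The bound on [K_2] gives
    [E |X_1|^8 = o(n M^2)]; hence [sum_i (G i i)^2] concentrates around [n M]
    by Chebyshev, [(max_i G i i)^2 = o(n M)] from [sum_i (G i i)^4], and the
    off-diagonal part has expected square at most [n^2 f^2 = o(n M)].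
    So [rho(S / fhat)] tends to [0], and [rho(S / fhat - Sigma / f)] tends to
    [0] exactly when [rho(Sigma / f)] does. *)

(** * Independence *)

Section Expectation.
Context {R : realType} {d : measure_display} {T : measurableType d}
  (P : probability T R).
Implicit Types U V : T -> R.

(** Independence says that the joint law of [U] and [V] is the product of their laws, so Tonelli
    gives integrability of the product and Fubini splits its mean. *)
Lemma integrable_indepM U V :
  measurable_fun setT U -> measurable_fun setT V ->
  (forall A B : set R, measurable A -> measurable B ->
     P (U @^-1` A `&` V @^-1` B) = (P (U @^-1` A) * P (V @^-1` B))%E) ->
  P.-integrable setT (EFin \o U) -> P.-integrable setT (EFin \o V) ->
  P.-integrable setT (EFin \o (U \* V)) /\
  (\int[P]_w (U w * V w) = (\int[P]_w U w) * (\int[P]_w V w))%R.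
Proof.
move=> mU mV UV iU iV.
pose U' : {mfun T >-> R} := HB.pack U (isMeasurableFun.Build _ _ _ _ U mU).
pose V' : {mfun T >-> R} := HB.pack V (isMeasurableFun.Build _ _ _ _ V mV).
pose mu1 := distribution P U'.
pose mu2 := distribution P V'.
pose phi w := (U w, V w).
have mphi : measurable_fun setT phi by exact: measurable_fun_pair.
pose phi' : {mfun T >-> (R * R)%type} :=
  HB.pack phi (isMeasurableFun.Build _ _ _ _ phi mphi).
pose mu := distribution P phi'.
(* A product measure is determined by its values on rectangles, and there the factorisation is the
   hypothesis [UV]. *)
have muE A : measurable A -> (mu1 \x mu2)%E A = mu A.
  apply: product_measure_unique => B C mB mC.
  exact: UV.
pose f (z : R * R) : \bar R := (z.1 * z.2)%:E.
have mf : measurable_fun setT f.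
  apply/measurable_EFinP; apply: measurable_funM.
    exact: measurable_fst.
  exact: measurable_snd.
have i1 : mu1.-integrable setT (EFin : R -> \bar R).
  apply: (@integrable_pushforward _ _ _ _ _ U mU P setT EFin) => //.
have i2 : mu2.-integrable setT (EFin : R -> \bar R).
  apply: (@integrable_pushforward _ _ _ _ _ V mV P setT EFin) => //.
have fin1 : (\int[mu1]_x `|x%:E| < +oo)%E by have /integrableP[] := i1.
have fin2 : (\int[mu2]_x `|x%:E| < +oo)%E by have /integrableP[] := i2.
(* The iterated integral of [|x y|] is the product of the two first absolute moments, which is
   finite. *)
have fi : (mu1 \x mu2)%E.-integrable setT f.
  apply/(integrable12ltyP mu1 mu2 mf).
  have E x : (\int[mu2]_y `|f (x, y)| = `|x%:E| * \int[mu2]_y `|y%:E|)%E.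
    rewrite -ge0_integralZl//.
    - by apply: eq_integral => y _; rewrite /f/= normrM EFinM.
    - exact: measurableT_comp.
  under eq_integral do rewrite E.
  rewrite ge0_integralZr//.
  - by rewrite lte_mul_pinfty// ?integral_ge0// ge0_fin_numE ?integral_ge0.
  - exact: measurableT_comp.
  - exact: integral_ge0.
have fphi : f \o phi = EFin \o (U \* V) by [].
have iUV : P.-integrable setT (EFin \o (U \* V)).
  apply/integrableP; split.
    by apply/measurable_EFinP; exact: measurable_funM.
  have /integrableP[_] := fi.
  rewrite (eq_measure_integral mu); last by move=> A mA _; exact: muE.
  rewrite ge0_integral_pushforward//.
  exact: measurableT_comp.
split => //.
rewrite /Rintegral -fineM//; [|exact: integrable_fin_num..].
congr fine.
transitivity (\int[mu]_z f z)%E.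
  by rewrite integral_pushforward.
rewrite -(eq_measure_integral mu (m1:=(mu1 \x mu2)%E)); last by move=> A mA _; exact: muE.
rewrite -integral12_prod_meas1//.
transitivity (\int[mu1]_x (x%:E * \int[mu2]_y y%:E))%E.
  apply: eq_integral => x _; rewrite /fubini_F -integralZl//.
rewrite -[X in (_ * X)%E](@integral_pushforward _ _ _ _ _ V mV P setT EFin)//.
rewrite -[X in (X * _)%E](@integral_pushforward _ _ _ _ _ U mU P setT EFin)//.
have fn : (\int[mu2]_y y%:E)%E \is a fin_num by exact: integrable_fin_num.
by rewrite -(fineK fn) integralZr.
Qed.
End Expectation.

(** * Integrable functions *)

Section L1.
Context {R : realType} {d : measure_display} {T : measurableType d}
  (P : probability T R).
Implicit Types f g : T -> R.

Local Notation L1 f := (P.-integrable [set: T] (EFin \o f)).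

Lemma L1_measurable f : L1 f -> measurable_fun setT f.
Proof. by move=> /measurable_int /measurable_EFinP. Qed.

Lemma L1_cst (c : R) : L1 (fun=> c).
Proof. exact: finite_measure_integrable_cst. Qed.

Lemma Rintegral_cstT (c : R) : \int[P]_w c = c.
Proof. by rewrite Rintegral_cst//= probability_setT/= mulr1. Qed.

Lemma L1Z (c : R) f : L1 f -> L1 (fun w => c * f w).
Proof.
by move=> ?; apply: (eq_integrable _ (fun w => c%:E * (EFin \o f) w)%E) => //;
  exact: integrableZl.
Qed.

Lemma L1D f g : L1 f -> L1 g -> L1 (fun w => f w + g w).
Proof.
by move=> ? ?; apply: (eq_integrable _ ((EFin \o f) \+ (EFin \o g))%E) => //;
  exact: integrableD.
Qed.

Lemma L1B f g : L1 f -> L1 g -> L1 (fun w => f w - g w).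
Proof.
by move=> ? ?; apply: (eq_integrable _ ((EFin \o f) \- (EFin \o g))%E) => //;
  exact: integrableB.
Qed.

Lemma L1_sum I (s : seq I) (h : I -> T -> R) :
  (forall i, L1 (h i)) -> L1 (fun w => \sum_(i <- s) h i w).
Proof.
move=> ih; elim: s => [|i s IH].
  under eq_fun do rewrite big_nil.
  exact: L1_cst.
by under eq_fun do rewrite big_cons; exact: L1D.
Qed.

Lemma Rintegral_sum I (s : seq I) (h : I -> T -> R) :
  (forall i, L1 (h i)) ->
  \int[P]_w (\sum_(i <- s) h i w) = \sum_(i <- s) \int[P]_w h i w.
Proof.
move=> ih; elim: s => [|i s IH].
  by under eq_Rintegral do rewrite big_nil; rewrite big_nil Rintegral_cstT.
under eq_Rintegral do rewrite big_cons.
by rewrite big_cons RintegralD// ?IH//; exact: L1_sum.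
Qed.

Lemma L1_le f g : measurable_fun setT f -> (forall w, `|f w| <= g w) ->
  L1 g -> L1 f.
Proof.
move=> mf fg ig; apply: (le_integrable _ _ _ ig) => //.
  exact/measurable_EFinP.
by move=> w _ /=; rewrite lee_fin (le_trans (fg w))// ler_norm.
Qed.

(** The product is dominated by the sum of the two squares. *)
Lemma L1_mul f g : measurable_fun setT f -> measurable_fun setT g ->
  L1 (fun w => f w ^+ 2) -> L1 (fun w => g w ^+ 2) -> L1 (fun w => f w * g w).
Proof.
move=> mf mg f2 g2; apply: (L1_le _ (fun w => f w ^+ 2 + g w ^+ 2)).
- exact: measurable_funM.
- move=> w; rewrite ler_norml; have := sqr_ge0 (f w + g w).
  have := sqr_ge0 (f w - g w); have := sqr_ge0 (f w); have := sqr_ge0 (g w).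
  by move: (f w) (g w) => x y *; apply/andP; split; nra.
- exact: L1D.
Qed.

Lemma L1_sqr f : measurable_fun setT f -> L1 (fun w => f w ^+ 2) -> L1 f.
Proof.
move=> mf f2; apply: (eq_integrable _ (EFin \o (fun w => f w * 1))) => //.
  by move=> w _ /=; rewrite mulr1.
by apply: L1_mul => //; exact: L1_cst.
Qed.

Lemma integral_L1 f : L1 f -> (\int[P]_w (f w)%:E = (\int[P]_w f w)%:E)%E.
Proof. by move=> If; rewrite /Rintegral fineK//; exact: integrable_fin_num. Qed.

Lemma L1_ge0 f : measurable_fun setT f -> (forall w, 0 <= f w) ->
  (\int[P]_w (f w)%:E < +oo)%E -> L1 f.
Proof.
move=> mf f0 fi; apply/integrableP; split; first exact/measurable_EFinP.
by under eq_integral do rewrite /= ger0_norm//.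
Qed.

Lemma markov_ge0 f (a : R) : 0 < a -> (forall w, 0 <= f w) -> L1 f ->
  (P [set w | (a <= f w)%R] <= ((\int[P]_w f w) / a)%:E)%E.
Proof.
move=> a0 f0 If.
have mf := L1_measurable _ If.
have := @le_integral_comp_abse _ _ _ P setT measurableT (EFin \o f) a id.
rewrite setTI => H.
rewrite [X in (_ <= X%:E)%E]mulrC EFinM lee_pdivlMl//.
rewrite -integral_L1//.
rewrite [X in (_ * P X)%E](_ : _ = [set x | a%:E <= `|(EFin \o f) x|]%E); last first.
  by apply/seteqP; split=> w /=; rewrite lee_fin ger0_norm.
apply: (le_trans (H _ _ _ _ _)) => //; first exact/measurable_EFinP.
by under eq_integral do rewrite /= ger0_norm//.
Qed.

(** Expanding the square into a double sum, orthogonality removes every term off the diagonal and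
    leaves [n] second moments. *)
Lemma variance_sum (n : nat) (W : nat -> T -> R) (B : R) :
  (forall i, (i < n)%N -> measurable_fun setT (W i)) ->
  (forall i, (i < n)%N -> L1 (fun w => W i w ^+ 2)) ->
  (forall i, (i < n)%N -> \int[P]_w (W i w ^+ 2) <= B) ->
  (forall i k, (i < n)%N -> (k < n)%N -> i != k -> \int[P]_w (W i w * W k w) = 0) ->
  L1 (fun w => (\sum_(i < n) W i w) ^+ 2) /\
  \int[P]_w ((\sum_(i < n) W i w) ^+ 2) <= n%:R * B.
Proof.
move=> mW W2 WB W0.
have iW (i k : 'I_n) : L1 (fun w => W i w * W k w).
  by apply: L1_mul => //; [exact: mW|exact: mW|exact: W2|exact: W2].
have E w : (\sum_(i < n) W i w) ^+ 2 = \sum_(i < n) \sum_(k < n) W i w * W k w.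
  by rewrite expr2 mulr_suml; apply: eq_bigr => i _; rewrite mulr_sumr.
split.
  under eq_fun do rewrite E.
  by apply: L1_sum => i; exact: L1_sum.
under eq_Rintegral do rewrite E.
rewrite Rintegral_sum; last by move=> i; exact: L1_sum.
rewrite [leRHS](_ : _ = \sum_(i < n) B); last first.
  by rewrite sumr_const card_ord mulr_natl.
apply: ler_sum => i _.
rewrite Rintegral_sum// (bigD1 i)//= big1 ?addr0.
  under eq_Rintegral do rewrite -expr2.
  exact: WB.
by move=> k ki; rewrite W0// eq_sym.
Qed.

End L1.

(** * Independent identically distributed random vectors *)

(* [<<s coord_preimages R p>>] is convertible to [cV_sigma p], so this makes
   ['cV[R]_p] a measurable type with exactly the sets used in the hypotheses. *)
Definition coord_preimages (R : realType) (p : nat) : set (set 'cV[R]_p) :=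
  [set C | exists (j : 'I_p) (B : set R), measurable B /\
             C = (fun v : 'cV[R]_p => v j ord0) @^-1` B].

Local Notation vec R p := (g_sigma_algebraType (coord_preimages R p)).

Lemma measurable_coord (R : realType) (p : nat) (j : 'I_p) :
  measurable_fun setT (fun v : vec R p => (v : 'cV[R]_p) j ord0).
Proof.
move=> _ B mB; rewrite setTI; apply: sub_sigma_algebra.
by exists j, B.
Qed.

Section IID.
Context {R : realType} {d : measure_display} {T : measurableType d}
  (P : probability T R) (n p : nat) (X : nat -> T -> 'cV[R]_p)
  (Sigma : 'M[R]_p).
Hypothesis iidX : iid_mean0_cov P n X Sigma.

Local Notation L1 f := (P.-integrable [set: T] (EFin \o f)).

Lemma measurable_X i : (i < n)%N -> measurable_fun setT (X i : T -> vec R p).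
Proof.
move=> iltn; have [mX _] := iidX.
apply: (@measurability _ _ T (vec R p) _ _ (coord_preimages R p)) => //.
move=> _ [_ [j [B [mB ->]]] <-].
exact: mX.
Qed.

Lemma measurable_comp_X (g : vec R p -> R) i : (i < n)%N ->
  measurable_fun setT g -> measurable_fun setT (fun w => g (X i w)).
Proof. by move=> iltn mg; exact: (measurableT_comp mg (measurable_X i iltn)). Qed.

(** The joint product formula is applied to a family equal to the whole space at every index other
    than [i] and [k]; those factors are 1. *)
Lemma probability_X2 i k (A B : set 'cV[R]_p) :
  (i < n)%N -> (k < n)%N -> i != k -> cV_sigma A -> cV_sigma B ->
  (P (X i @^-1` A `&` X k @^-1` B) = P (X i @^-1` A) * P (X k @^-1` B))%E.
Proof.
move=> iltn kltn ik mA mB; have [_ [_ [_ [_ [indX _]]]]] := iidX.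
pose C j := if j == i then A else if j == k then B else setT.
have := indX C.
have CT j : j != i -> j != k -> C j = setT.
  by rewrite /C => /negPf -> /negPf ->.
have Ci : C i = A by rewrite /C eqxx.
have Ck : C k = B by rewrite /C eqxx eq_sym (negPf ik).
have -> : \bigcap_(j < n) (X j @^-1` C j) = X i @^-1` A `&` X k @^-1` B.
  apply/seteqP; split => w /=.
    by move=> H; split; [have := H i iltn|have := H k kltn]; rewrite ?Ci ?Ck.
  move=> [wA wB] j /= _; have [->|ji] := eqVneq j i; first by rewrite Ci.
  by have [->|jk] := eqVneq j k; [rewrite Ck|rewrite CT].
move=> -> /=; last first.
  move=> j _; rewrite /C; case: ifP => // _; case: ifP => // _.
  exact: (@measurableT _ (vec R p)).
rewrite (bigD1 (Ordinal iltn))//= (bigD1 (Ordinal kltn))/=; last first.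
  by rewrite -val_eqE /= eq_sym.
rewrite Ci Ck big1 ?mule1// => j /andP[ji jk].
by rewrite CT// preimage_setT probability_setT.
Qed.

Lemma expectation_X2 (g h : vec R p -> R) i k :
  (i < n)%N -> (k < n)%N -> i != k ->
  measurable_fun setT g -> measurable_fun setT h ->
  L1 (fun w => g (X i w)) -> L1 (fun w => h (X k w)) ->
  L1 (fun w => g (X i w) * h (X k w)) /\
  \int[P]_w (g (X i w) * h (X k w)) =
    (\int[P]_w g (X i w)) * (\int[P]_w h (X k w)).
Proof.
move=> iltn kltn ik mg mh; apply: integrable_indepM.
- exact: measurable_comp_X.
- exact: measurable_comp_X.
- move=> A B mA mB; apply: (@probability_X2 i k (g @^-1` A) (h @^-1` B)) => //.
  + by rewrite -[X in cV_sigma X]setTI; exact: mg.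
  + by rewrite -[X in cV_sigma X]setTI; exact: mh.
Qed.

(** Stated for extended-real integrals of nonnegative functions, so that no integrability is
    assumed: applied to an absolute value, it carries integrability from one index to another. *)
Lemma ge0_expectation_X (g : vec R p -> R) i k : (i < n)%N -> (k < n)%N ->
  measurable_fun setT g -> (forall v, 0 <= g v) ->
  (\int[P]_w (g (X i w))%:E = \int[P]_w (g (X k w))%:E)%E.
Proof.
move=> iltn kltn mg g0; have [_ [_ [_ [_ [_ identX]]]]] := iidX.
have mEg : measurable_fun setT (EFin \o g) by exact/measurable_EFinP.
pose Xi : {mfun T >-> vec R p} :=
  HB.pack (X i : T -> vec R p) (isMeasurableFun.Build _ _ _ _ _ (measurable_X i iltn)).
pose Xk : {mfun T >-> vec R p} :=
  HB.pack (X k : T -> vec R p) (isMeasurableFun.Build _ _ _ _ _ (measurable_X k kltn)).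
transitivity (\int[distribution P Xi]_v (g v)%:E)%E.
  by rewrite ge0_integral_pushforward// => v _; rewrite lee_fin.
transitivity (\int[distribution P Xk]_v (g v)%:E)%E; last first.
  by rewrite ge0_integral_pushforward// => v _; rewrite lee_fin.
by apply: eq_measure_integral => A mA _; exact: (identX i k A).
Qed.

Lemma L1_X (g : vec R p -> R) i k : (i < n)%N -> (k < n)%N ->
  measurable_fun setT g -> L1 (fun w => g (X i w)) -> L1 (fun w => g (X k w)).
Proof.
move=> iltn kltn mg /integrableP[_ gi]; apply/integrableP; split.
  by apply/measurable_EFinP; exact: measurable_comp_X.
apply: le_lt_trans gi.
rewrite (ge0_expectation_X (fun v => `|g v|) k i)//.
exact: measurableT_comp.
Qed.

Lemma expectation_X (g : vec R p -> R) i k : (i < n)%N -> (k < n)%N ->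
  measurable_fun setT g -> L1 (fun w => g (X i w)) ->
  \int[P]_w g (X i w) = \int[P]_w g (X k w).
Proof.
move=> iltn kltn mg gi; have [_ [_ [_ [_ [_ identX]]]]] := iidX.
have gk := L1_X g i k iltn kltn mg gi.
have mEg : measurable_fun setT (EFin \o g) by exact/measurable_EFinP.
congr fine.
pose Xi : {mfun T >-> vec R p} :=
  HB.pack (X i : T -> vec R p) (isMeasurableFun.Build _ _ _ _ _ (measurable_X i iltn)).
pose Xk : {mfun T >-> vec R p} :=
  HB.pack (X k : T -> vec R p) (isMeasurableFun.Build _ _ _ _ _ (measurable_X k kltn)).
transitivity (\int[distribution P Xi]_v (g v)%:E)%E.
  by rewrite integral_pushforward//.
transitivity (\int[distribution P Xk]_v (g v)%:E)%E; last first.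
  by rewrite integral_pushforward//.
by apply: eq_measure_integral => A mA _; exact: (identX i k A).
Qed.

(** The centred variables are pairwise orthogonal by independence. Their variance is bounded by the
    raw second moment, the term [- m ^+ 2] being dropped. *)
Lemma variance_sum_X (g : vec R p -> R) (m := \int[P]_w g (X 0 w)) :
  (0 < n)%N -> measurable_fun setT g -> L1 (fun w => g (X 0 w) ^+ 2) ->
  L1 (fun w => (\sum_(i < n) (g (X i w) - m)) ^+ 2) /\
  \int[P]_w ((\sum_(i < n) (g (X i w) - m)) ^+ 2) <=
    n%:R * \int[P]_w (g (X 0 w) ^+ 2).
Proof.
move=> n0 mg g2.
have g20 i : (i < n)%N -> L1 (fun w => g (X i w) ^+ 2).
  move=> iltn; apply: (L1_X (fun v => g v ^+ 2) 0) => //.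
  exact: measurable_funX.
have g1 i : (i < n)%N -> L1 (fun w => g (X i w)).
  by move=> iltn; apply: L1_sqr; [exact: measurable_comp_X|exact: g20].
have mgm : measurable_fun setT (fun v : vec R p => g v - m).
  exact: measurable_funB.
have gm i : (i < n)%N -> L1 (fun w => g (X i w) - m).
  by move=> iltn; apply: L1B; [exact: g1|exact: L1_cst].
have E w i : (g (X i w) - m) ^+ 2 = g (X i w) ^+ 2 + (- (2 * m) * g (X i w) + m ^+ 2).
  by ring.
have Em i : (i < n)%N -> \int[P]_w (g (X i w)) = m.
  by move=> iltn; rewrite (expectation_X g i 0)//; exact: g1.
have gmi i : (i < n)%N -> L1 (fun w => - (2 * m) * g (X i w) + m ^+ 2).
  move=> iltn; apply: L1D; last exact: L1_cst.
  by apply: L1Z; exact: g1.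
apply: (variance_sum P n (fun i w => g (X i w) - m)).
- by move=> i iltn; exact: (measurable_comp_X (fun v => g v - m)).
- move=> i iltn; under eq_fun do rewrite E.
  by apply: L1D; [exact: g20|exact: gmi].
- move=> i iltn; under eq_Rintegral do rewrite E.
  rewrite RintegralD//; [|exact: g20|exact: gmi].
  rewrite RintegralD//; [|by apply: L1Z; exact: g1|exact: L1_cst].
  rewrite RintegralZl//; last exact: g1.
  rewrite Rintegral_cstT Em//.
  rewrite (expectation_X (fun v => g v ^+ 2) i 0)//; [|exact: measurable_funX|exact: g20].
  by have := sqr_ge0 m; lra.
- move=> i k iltn kltn ik.
  have [_ ->] := expectation_X2 _ _ i k iltn kltn ik mgm mgm (gm i iltn) (gm k kltn).
  rewrite RintegralB//; [|exact: g1|exact: L1_cst].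
  by rewrite Rintegral_cstT Em// subrr mul0r.
Qed.

End IID.

(** * Spectral and Frobenius norms *)

Section SpectralNorm.
Context {R : realType}.

(** Lagrange's identity: twice the gap is a double sum of the squares of [a i * b j - a j * b i]. *)
Lemma cauchy_schwarz (I : finType) (Q : pred I) (a b : I -> R) :
  (\sum_(i | Q i) a i * b i) ^+ 2 <=
  (\sum_(i | Q i) a i ^+ 2) * (\sum_(i | Q i) b i ^+ 2).
Proof.
rewrite -subr_ge0 -(pmulr_rge0 _ (ltr0n R 2)).
have -> : 2 * ((\sum_(i | Q i) a i ^+ 2) * (\sum_(i | Q i) b i ^+ 2) -
   (\sum_(i | Q i) a i * b i) ^+ 2) =
   \sum_(i | Q i) \sum_(j | Q j) (a i * b j - a j * b i) ^+ 2.
  have E i j : (a i * b j - a j * b i) ^+ 2 =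
     a i ^+ 2 * b j ^+ 2 + b i ^+ 2 * a j ^+ 2 + (- 2 * (a i * b i)) * (a j * b j).
    by ring.
  under [RHS]eq_bigr do under eq_bigr do rewrite E.
  under [RHS]eq_bigr do rewrite !big_split/= -!mulr_sumr.
  by rewrite !big_split/= -!mulr_suml -mulr_sumr; ring.
by apply: sumr_ge0 => i _; apply: sumr_ge0 => j _; exact: sqr_ge0.
Qed.

Lemma vnorm_ge0 p (v : 'cV[R]_p) : 0 <= vnorm v.
Proof. exact: sqrtr_ge0. Qed.

Lemma vnorm_sqr p (v : 'cV[R]_p) : vnorm v ^+ 2 = \sum_(j < p) v j ord0 ^+ 2.
Proof. by rewrite sqr_sqrtr// sumr_ge0// => j _; exact: sqr_ge0. Qed.

Lemma vnormZ p (c : R) (v : 'cV[R]_p) : vnorm (c *: v) = `|c| * vnorm v.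
Proof.
rewrite /vnorm -sqrtr_sqr -sqrtrM ?sqr_ge0//; congr Num.sqrt.
by rewrite mulr_sumr; apply: eq_bigr => j _; rewrite mxE exprMn.
Qed.

Lemma vnorm_dot p (u v : 'cV[R]_p) :
  \sum_(j < p) u j ord0 * v j ord0 <= vnorm u * vnorm v.
Proof.
rewrite (le_trans (ler_norm _))// -(@ler_pXn2r _ 2)// ?nnegrE ?mulr_ge0 ?vnorm_ge0//.
by rewrite real_normK ?num_real// exprMn !vnorm_sqr; exact: cauchy_schwarz.
Qed.

Lemma vnormD p (u v : 'cV[R]_p) : vnorm (u + v) <= vnorm u + vnorm v.
Proof.
rewrite -(@ler_pXn2r _ 2)// ?nnegrE ?addr_ge0 ?vnorm_ge0// sqrrD !vnorm_sqr.
have -> : \sum_(j < p) (u + v) j ord0 ^+ 2 = \sum_(j < p) u j ord0 ^+ 2 +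
    (\sum_(j < p) u j ord0 * v j ord0) *+ 2 + \sum_(j < p) v j ord0 ^+ 2.
  by rewrite -sumrMnl -!big_split/=; apply: eq_bigr => j _; rewrite mxE sqrrD.
by rewrite lerD2r lerD2l lerMn2r/= vnorm_dot.
Qed.

Lemma vnorm0 p : vnorm (0 : 'cV[R]_p) = 0.
Proof. by rewrite -(scale0r 0) vnormZ normr0 mul0r. Qed.

Lemma vnorm_eq0 p (v : 'cV[R]_p) : vnorm v = 0 -> v = 0.
Proof.
move=> v0; apply/matrixP => i j; rewrite !mxE ord1; apply/eqP.
have /eqP : \sum_(j < p) v j ord0 ^+ 2 = 0 by rewrite -vnorm_sqr v0 expr0n.
rewrite psumr_eq0; last by move=> k _; exact: sqr_ge0.
by move=> /allP/(_ i (mem_index_enum _)) /=; rewrite sqrf_eq0.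
Qed.

Lemma frob2_ge0 p q (A : 'M[R]_(p, q)) : 0 <= frob2 A.
Proof. by apply: sumr_ge0 => i _; apply: sumr_ge0 => j _; exact: sqr_ge0. Qed.

Lemma vnorm_mulmx p q (A : 'M[R]_(p, q)) (v : 'cV[R]_q) :
  vnorm (A *m v) <= Num.sqrt (frob2 A) * vnorm v.
Proof.
rewrite -(@ler_pXn2r _ 2)// ?nnegrE ?mulr_ge0 ?vnorm_ge0 ?sqrtr_ge0//.
rewrite exprMn !vnorm_sqr (sqr_sqrtr (frob2_ge0 _ _ A)) /frob2 mulr_suml.
by apply: ler_sum => i _; rewrite mxE; exact: cauchy_schwarz.
Qed.

Lemma spec_norm_has_sup p q (A : 'M[R]_(p, q)) :
  has_sup [set x | exists v : 'cV[R]_q, vnorm v <= 1 /\ x = vnorm (A *m v)].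
Proof.
split; first by exists (vnorm (A *m 0)), 0; rewrite vnorm0.
exists (Num.sqrt (frob2 A)) => _ [v [v1 ->]].
by rewrite (le_trans (vnorm_mulmx _ _ _ _))// ler_piMr// sqrtr_ge0.
Qed.

Lemma le_spec_norm p q (A : 'M[R]_(p, q)) (v : 'cV[R]_q) :
  vnorm (A *m v) <= spec_norm A * vnorm v.
Proof.
have [v0|v0] := eqVneq (vnorm v) 0.
  by rewrite v0 mulr0 (vnorm_eq0 _ _ v0) mulmx0 vnorm0.
have v_gt0 : 0 < vnorm v by rewrite lt_neqAle eq_sym v0 vnorm_ge0.
rewrite -ler_pdivrMr// mulrC -[X in X * _]ger0_norm ?invr_ge0 ?vnorm_ge0//.
rewrite -vnormZ scalemxAr.
apply: ub_le_sup; first by have [] := spec_norm_has_sup _ _ A.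
exists ((vnorm v)^-1 *: v); split => //.
by rewrite vnormZ ger0_norm ?invr_ge0 ?vnorm_ge0// mulVf.
Qed.

Lemma spec_norm_le p q (A : 'M[R]_(p, q)) (c : R) : 0 <= c ->
  (forall v : 'cV[R]_q, vnorm (A *m v) <= c * vnorm v) -> spec_norm A <= c.
Proof.
move=> c0 Ac; apply: ge_sup; first by have [] := spec_norm_has_sup _ _ A.
by move=> _ [v [v1 ->]]; rewrite (le_trans (Ac v))// ler_piMr.
Qed.

Lemma spec_norm_ge0 p q (A : 'M[R]_(p, q)) : 0 <= spec_norm A.
Proof.
apply: ub_le_sup; first by have [] := spec_norm_has_sup _ _ A.
by exists 0; rewrite mulmx0 !vnorm0 ler01.
Qed.

Lemma spec_norm_frob p q (A : 'M[R]_(p, q)) : spec_norm A <= Num.sqrt (frob2 A).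
Proof. by apply: spec_norm_le; [exact: sqrtr_ge0|exact: vnorm_mulmx]. Qed.

Lemma spec_normD p q (A B : 'M[R]_(p, q)) :
  spec_norm (A + B) <= spec_norm A + spec_norm B.
Proof.
apply: spec_norm_le => [|v]; first by rewrite addr_ge0 ?spec_norm_ge0.
by rewrite mulmxDl (le_trans (vnormD _ _ _))// mulrDl lerD ?le_spec_norm.
Qed.

Lemma spec_normZ_le p q (c : R) (A : 'M[R]_(p, q)) :
  spec_norm (c *: A) <= `|c| * spec_norm A.
Proof.
apply: spec_norm_le => [|v]; first by rewrite mulr_ge0 ?spec_norm_ge0.
by rewrite -scalemxAl vnormZ -mulrA ler_wpM2l// le_spec_norm.
Qed.

Lemma spec_normN p q (A : 'M[R]_(p, q)) : spec_norm (- A) = spec_norm A.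
Proof.
apply/eqP; rewrite eq_le; apply/andP; split.
  by rewrite -scaleN1r (le_trans (spec_normZ_le _ _ _ _))// normrN1 mul1r.
rewrite -[X in spec_norm X <= _]opprK -scaleN1r.
by rewrite (le_trans (spec_normZ_le _ _ _ _))// normrN1 mul1r.
Qed.

Lemma spec_normZ p q (c : R) (A : 'M[R]_(p, q)) :
  spec_norm (c *: A) = `|c| * spec_norm A.
Proof.
apply/eqP; rewrite eq_le spec_normZ_le/=.
have [->|c0] := eqVneq c 0; first by rewrite normr0 mul0r spec_norm_ge0.
rewrite -ler_pdivlMl ?normr_gt0// -normfV (le_trans _ (spec_normZ_le _ _ _ _))//.
by rewrite scalerA mulVf// scale1r.
Qed.

(* With [u i] the inner product of [x i] and [v], [|A v|^2] is the Gram
   quadratic form at [u], and [|u|^2] is the inner product of [v] and [A v]. *)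
Lemma spec_norm_gram n p (x : 'I_n -> 'cV[R]_p) (g : R)
  (G := fun i k => \sum_(j < p) x i j ord0 * x k j ord0) :
  0 <= g ->
  (forall u : 'I_n -> R, \sum_(i < n) \sum_(k < n) u i * u k * G i k <=
     g * \sum_(i < n) u i ^+ 2) ->
  spec_norm (\sum_(i < n) (x i *m (x i)^T)) <= g.
Proof.
move=> g0 Gg; apply: spec_norm_le => // v.
set A := \sum_(i < n) _.
pose u i := \sum_(j < p) x i j ord0 * v j ord0.
have Av j : (A *m v) j ord0 = \sum_(i < n) u i * x i j ord0.
  rewrite /A mulmx_suml summxE; apply: eq_bigr => i _.
  rewrite -mulmxA mxE big_ord1 mulrC; congr (_ * _).
  by rewrite mxE; apply: eq_bigr => l _; rewrite mxE.
have Av2 : vnorm (A *m v) ^+ 2 <= g * \sum_(i < n) u i ^+ 2.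
  rewrite vnorm_sqr (le_trans _ (Gg u))//.
  under eq_bigr do rewrite Av expr2 mulr_suml.
  rewrite exchange_big/=; apply: ler_sum => i _.
  under eq_bigr do rewrite mulr_sumr.
  rewrite exchange_big/=; apply: ler_sum => k _.
  by rewrite /G mulr_sumr; apply: ler_sum => j _; rewrite mulrACA.
have u2 : \sum_(i < n) u i ^+ 2 <= vnorm v * vnorm (A *m v).
  rewrite (le_trans _ (vnorm_dot _ _ _))//.
  under [leRHS]eq_bigr do rewrite Av mulr_sumr.
  rewrite exchange_big/=; apply: ler_sum => i _.
  rewrite expr2 {2}/u mulr_sumr; apply: ler_sum => j _.
  by rewrite mulrC mulrCA mulrA [_ * v _ _]mulrC mulrC -!mulrA mulrCA.
(* The two bounds chain to [|A v|^2 <= g |v| |A v|]; one factor [|A v|] cancels unless it is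
   zero. *)
have [->|Av0] := eqVneq (vnorm (A *m v)) 0; first by rewrite mulr_ge0 ?vnorm_ge0.
have Av_gt0 : 0 < vnorm (A *m v) by rewrite lt_neqAle eq_sym Av0 vnorm_ge0.
rewrite -(ler_pM2r Av_gt0) -expr2 (le_trans Av2)// -mulrA.
exact: ler_wpM2l.
Qed.

(** The Gram quadratic form at [u] splits in two: its diagonal part is at most [a |u|^2], and
    Cauchy-Schwarz over the pairs [k != i] bounds the rest by [b |u|^2]. *)
Lemma spec_norm_gram_diag n p (x : 'I_n -> 'cV[R]_p) (a b : R)
  (G := fun i k => \sum_(j < p) x i j ord0 * x k j ord0) :
  0 <= a -> 0 <= b -> (forall i, G i i <= a) ->
  \sum_(i < n) \sum_(k < n | k != i) G i k ^+ 2 <= b ^+ 2 ->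
  spec_norm (\sum_(i < n) (x i *m (x i)^T)) <= a + b.
Proof.
move=> a0 b0 Ga Gb; apply: spec_norm_gram => [|u]; first exact: addr_ge0.
under eq_bigr => i _ do rewrite (bigD1 i)//=.
rewrite big_split/= mulrDl lerD//.
  rewrite mulr_sumr; apply: ler_sum => i _.
  by rewrite -expr2 mulrC ler_wpM2r ?sqr_ge0// Ga.
rewrite (le_trans (ler_norm _))// -(@ler_pXn2r _ 2)// ?nnegrE//; last first.
  by rewrite mulr_ge0// sumr_ge0// => i _; exact: sqr_ge0.
rewrite real_normK ?num_real//.
rewrite pair_big_dep/=.
apply: (le_trans (cauchy_schwarz _ _ (fun z : 'I_n * 'I_n => u z.1 * u z.2)
  (fun z => G z.1 z.2))).
rewrite mulrC exprMn ler_pM// ?sumr_ge0//; [by move=> *; exact: sqr_ge0..| |].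
  by rewrite -(pair_big_dep xpredT (fun i k => k != i) (fun i k => G i k ^+ 2)).
rewrite expr2 mulr_suml -(pair_big_dep xpredT (fun i k : 'I_n => k != i)
  (fun i k => (u i * u k) ^+ 2))/=.
apply: ler_sum => i _; rewrite mulr_sumr.
(* The missing term [k = i] is nonnegative, so restoring it only enlarges the sum, up to the square
   of [|u|^2]. *)
rewrite [leRHS](bigD1 i)//= ler_wpDl//; first by apply: mulr_ge0; exact: sqr_ge0.
by apply: ler_sum => k _; rewrite exprMn.
Qed.

End SpectralNorm.

(** * Frobenius norm, normalisation, and the trace formula for the Gram matrix *)

Section Frobenius.
Context {R : realType}.

Lemma frob2_eq0 p q (A : 'M[R]_(p, q)) : frob2 A = 0 -> A = 0.
Proof.
move=> /eqP; rewrite /frob2 pair_big/= psumr_eq0 => [|? _]; last exact: sqr_ge0.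
move=> /allP A0; apply/matrixP => i j; rewrite mxE; apply/eqP.
by have := A0 (i, j) (mem_index_enum _); rewrite /= sqrf_eq0.
Qed.

Lemma frob2Z p q (c : R) (A : 'M[R]_(p, q)) : frob2 (c *: A) = c ^+ 2 * frob2 A.
Proof.
rewrite /frob2 mulr_sumr; apply: eq_bigr => i _; rewrite mulr_sumr.
by apply: eq_bigr => j _; rewrite mxE exprMn.
Qed.

(** Both sides depend only on the norms [a], [b] of the two matrices and on their inner product [c],
    so the claim is a scalar inequality under [|c| <= a b]. *)
Lemma frob2_normalizedB p q (A B : 'M[R]_(p, q)) : B != 0 ->
  frob2 ((Num.sqrt (frob2 A))^-1 *: A - (Num.sqrt (frob2 B))^-1 *: B) <=
  4 / frob2 B * frob2 (A - B).
Proof.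
move=> B0.
have fB : 0 < frob2 B.
  by rewrite lt_neqAle frob2_ge0 andbT eq_sym; apply: contra_neq B0; exact: frob2_eq0.
pose c := \sum_(i < p) \sum_(j < q) A i j * B i j.
have c2 : c ^+ 2 <= frob2 A * frob2 B.
  by rewrite /c /frob2 !pair_big; exact: cauchy_schwarz.
have E x y : frob2 (x *: A - y *: B) =
    x ^+ 2 * frob2 A - 2 * x * y * c + y ^+ 2 * frob2 B.
  rewrite /frob2 /c !mulr_sumr -sumrB -big_split/=; apply: eq_bigr => i _.
  rewrite !mulr_sumr -sumrB -big_split/=; apply: eq_bigr => j _.
  by rewrite !mxE; ring.
have AB : A - B = 1 *: A - 1 *: B by rewrite !scale1r.
rewrite AB !E.
set a := Num.sqrt (frob2 A); set b := Num.sqrt (frob2 B).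
have b0 : 0 < b by rewrite sqrtr_gt0.
have a0 : 0 <= a by exact: sqrtr_ge0.
have Ea : frob2 A = a ^+ 2 by rewrite sqr_sqrtr ?frob2_ge0.
have Eb : frob2 B = b ^+ 2 by rewrite sqr_sqrtr ?frob2_ge0.
have {c2} : `|c| <= a * b.
  rewrite -(@ler_pXn2r _ 2)// ?nnegrE ?mulr_ge0 ?(ltW b0)//.
  by rewrite real_normK ?num_real// exprMn -Ea -Eb.
rewrite Ea Eb ler_norml => /andP[c1 c2].
have bn0 : b != 0 by rewrite gt_eqF.
(* The inverse of 0 is 0, so a zero [A] normalises to zero; the two sides are then 1 and 4. *)
have [a00|an0] := eqVneq a 0.
  rewrite a00 invr0 expr0n/= !(mul0r, mulr0) subr0 add0r.
  have c0 : c = 0 by apply/eqP; rewrite eq_le; move: c1 c2; rewrite a00 mul0r oppr0 => -> ->.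
  rewrite c0 !mulr0 subr0 add0r expr1n mul1r divfK ?expf_neq0//.
  by rewrite -exprMn mulVf// expr1n ler1n.
have a_gt0 : 0 < a by rewrite lt_neqAle eq_sym an0.
rewrite -subr_ge0.
have -> : 4 / b ^+ 2 * (1 ^+ 2 * a ^+ 2 - 2 * 1 * 1 * c + 1 ^+ 2 * b ^+ 2) -
  (a^-1 ^+ 2 * a ^+ 2 - 2 * a^-1 * b^-1 * c + b^-1 ^+ 2 * b ^+ 2) =
  (4 * a ^+ 3 + 2 * a * b ^+ 2 + c * (2 * b - 8 * a)) / (a * b ^+ 2).
  by field; rewrite an0 bn0.
apply: divr_ge0; last by rewrite mulr_ge0 ?sqr_ge0.
(* The numerator is affine in [c], so it is least at an endpoint: at [c = - a b] if the slope
   [2 b - 8 a] is nonnegative, at [c = a b] otherwise. *)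
have [ab|ab] := lerP (4 * a) b.
  have : - (a * b) * (2 * b - 8 * a) <= c * (2 * b - 8 * a).
    by apply: ler_wpM2r => //; lra.
  suff : 0 <= 4 * a ^+ 3 + 8 * a ^+ 2 * b by nra.
  by rewrite addr_ge0// ?mulr_ge0// ?exprn_ge0// ltW.
have : (a * b) * (2 * b - 8 * a) <= c * (2 * b - 8 * a).
  by apply: ler_wnM2r => //; lra.
suff : 0 <= 4 * a * (a - b) ^+ 2 by nra.
by rewrite mulr_ge0 ?sqr_ge0// mulr_ge0.
Qed.

(** The trace in [fnorm] sums the products [A i j * A j i], which symmetry turns into squares. *)
Lemma fnorm_sym p (A : 'M[R]_p) : A^T = A -> fnorm A = Num.sqrt (frob2 A).
Proof.
move=> AT; congr Num.sqrt; rewrite /mxtrace /frob2; apply: eq_bigr => i _.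
by rewrite mxE; apply: eq_bigr => j _; rewrite -{2}AT mxE expr2.
Qed.

Lemma sample_cov_sym (T : Type) (n p : nat) (X : nat -> T -> 'cV[R]_p) w :
  (sample_cov n X w)^T = sample_cov n X w.
Proof.
rewrite /sample_cov linearZ/= raddf_sum/=; congr (_ *: _).
by apply: eq_bigr => i _; rewrite trmx_mul trmxK.
Qed.

Lemma sample_covE (T : Type) (n p : nat) (X : nat -> T -> 'cV[R]_p) w j k :
  sample_cov n X w j k =
  n%:R^-1 * \sum_(i < n) X i w j ord0 * X i w k ord0.
Proof.
rewrite mxE summxE; congr (_ * _); apply: eq_bigr => i _.
by rewrite mxE big_ord1 mxE.
Qed.

(** With the [x i] as columns of a matrix [Y], this says that [Y Y^T] and [Y^T Y] have the same
    Frobenius norm: both squares are one fourfold sum, read in two orders. *)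
Lemma frob2_gram n p (x : 'I_n -> 'cV[R]_p) :
  frob2 (\sum_(i < n) (x i *m (x i)^T)) =
  \sum_(i < n) \sum_(k < n) (\sum_(j < p) x i j ord0 * x k j ord0) ^+ 2.
Proof.
rewrite /frob2.
transitivity (\sum_(j < p) \sum_(l < p) \sum_(i < n) \sum_(k < n)
    (x i j ord0 * x i l ord0) * (x k j ord0 * x k l ord0)).
  apply: eq_bigr => j _; apply: eq_bigr => l _.
  have -> : (\sum_(i < n) x i *m (x i)^T) j l = \sum_(i < n) x i j ord0 * x i l ord0.
    by rewrite summxE; apply: eq_bigr => i _; rewrite mxE big_ord1 mxE.
  by rewrite expr2 mulr_suml; apply: eq_bigr => i _; rewrite mulr_sumr.
under eq_bigr do rewrite exchange_big/=.
rewrite exchange_big/=; apply: eq_bigr => i _.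
under eq_bigr do rewrite exchange_big/=.
rewrite exchange_big/=; apply: eq_bigr => k _.
rewrite expr2 mulr_suml; apply: eq_bigr => j _; rewrite mulr_sumr.
by apply: eq_bigr => l _; ring.
Qed.

End Frobenius.

(** * Measurability of norms, inverses and spectral level sets *)

Section Measurability.
Context {R : realType} {d : measure_display} {T : measurableType d}.

Lemma measurable_vnorm p (v : T -> 'cV[R]_p) :
  (forall j, measurable_fun setT (fun w => v w j ord0)) ->
  measurable_fun setT (fun w => vnorm (v w)).
Proof.
move=> mv.
apply: (@measurableT_comp _ _ _ _ _ _ (@Num.sqrt R) setT
  (fun w => \sum_(j < p) v w j ord0 ^+ 2)).
  exact: continuous_measurable_fun (@sqrt_continuous R).
by apply: measurable_sum => j; exact: measurable_funX.
Qed.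

Lemma measurable_frob2 p q (A : T -> 'M[R]_(p, q)) :
  (forall i j, measurable_fun setT (fun w => A w i j)) ->
  measurable_fun setT (fun w => frob2 (A w)).
Proof.
move=> mA; apply: measurable_sum => i; apply: measurable_sum => j.
exact: measurable_funX.
Qed.

Lemma measurable_fun_inv (f : T -> R) : (forall w, 0 <= f w) ->
  measurable_fun setT f -> measurable_fun setT (fun w => (f w)^-1).
Proof.
move=> f0 mf.
(* The power with exponent -1 is measurable and agrees with the inverse on nonnegative reals,
   including 0, where both vanish. *)
have -> : (fun w => (f w)^-1) = (fun x : R => x `^ (-1)) \o f.
  by apply/funext => w /=; rewrite powR_inv1.
by apply: measurableT_comp => //; exact: measurable_powR.
Qed.

(* Rational test vectors make the level sets of [spec_norm] countable unions. *)
Lemma spec_norm_gtP p q (A : 'M[R]_(p, q)) (y : R) : 0 <= y ->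
  y < spec_norm A <-> exists v : 'cV[rat]_q,
    y * vnorm (map_mx ratr v) < vnorm (A *m map_mx ratr v).
Proof.
move=> y0; split; last first.
  move=> [v yv]; rewrite ltNge; apply/negP => Ay; move: yv; apply/negP.
  by rewrite -leNgt (le_trans (le_spec_norm _ _ _ _))// ler_wpM2r// vnorm_ge0.
move=> yA; have [v yv] : exists v : 'cV[R]_q, y * vnorm v < vnorm (A *m v).
  apply: contrapT => /forallNP H; move: yA; apply/negP; rewrite -leNgt.
  by apply: spec_norm_le => // v; rewrite leNgt; apply/negP; exact: H.
pose D := vnorm (A *m v) - y * vnorm v.
have D0 : 0 < D by rewrite subr_gt0.
(* Replacing [v] by [u] changes the strict inequality by at most [L |v - u|]. Since
   [|v - u| <= q e], the choice of [e] keeps this below the slack [D]; the added ones keep the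
   denominators positive. *)
pose L := Num.sqrt (frob2 A) + y.
have L0 : 0 <= L by rewrite addr_ge0// sqrtr_ge0.
pose e := D / ((L + 1) * (q%:R + 1)).
have L1 : 0 < L + 1 by rewrite ltr_wpDl.
have q1 : 0 < q%:R + 1 :> R by rewrite ltr_wpDl.
have e0 : 0 < e by rewrite divr_gt0// mulr_gt0.
have H j : exists r : rat, `|v j ord0 - ratr r| < e.
  have [r] := @rat_in_itvoo R (v j ord0 - e) (v j ord0 + e) ltac:(by lra).
  by rewrite in_itv/= => /andP[r1 r2]; exists r; rewrite ltr_norml; apply/andP; split; lra.
have [r Hr] := choice H.
exists (\col_j r j); set u := map_mx _ _.
have uv : vnorm (v - u) <= q%:R * e.
  rewrite -(@ler_pXn2r _ 2)// ?nnegrE ?vnorm_ge0 ?(mulr_ge0 (ler0n _ _) (ltW e0))//.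
  rewrite vnorm_sqr (@le_trans _ _ (\sum_(j < q) e ^+ 2))//.
    apply: ler_sum => j _; rewrite !mxE -[leLHS]real_normK ?num_real//.
    by rewrite ler_pXn2r ?nnegrE ?(ltW e0)// ltW.
  rewrite sumr_const card_ord -[leLHS]mulr_natl [(q%:R * e) ^+ 2]exprMn ler_wpM2r ?sqr_ge0//.
  by rewrite -natrX ler_nat; case: (q) => // k; rewrite leq_pmulr.
have Auv := vnorm_mulmx _ _ A (v - u).
have h1 : vnorm (A *m v) <= vnorm (A *m u) + vnorm (A *m (v - u)).
  by rewrite (le_trans _ (vnormD _ _ _))// -mulmxDr addrC subrK.
have h2 : vnorm u <= vnorm v + vnorm (v - u).
  have -> : vnorm (v - u) = vnorm (u - v).
    by rewrite -opprB -scaleN1r vnormZ normrN1 mul1r.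
  by rewrite (le_trans _ (vnormD _ _ _))// addrC subrK.
have h3 : y * vnorm u <= y * vnorm v + y * vnorm (v - u).
  by rewrite -mulrDr ler_wpM2l.
have h4 : L * vnorm (v - u) < D.
  apply: (@le_lt_trans _ _ (L * (q%:R * e))); first by rewrite ler_wpM2l.
  have -> : L * (q%:R * e) = D * (L / (L + 1) * (q%:R / (q%:R + 1))).
    by rewrite /e; field; rewrite ?(gt_eqF L1) ?(gt_eqF q1).
  rewrite gtr_pMr// mulr_ilt1 ?divr_ge0 ?(ltW L1) ?(ltW q1)//.
    by rewrite ltr_pdivrMr// mul1r ltrDl.
  by rewrite ltr_pdivrMr// mul1r ltrDl.
by move: h4; rewrite /L /D mulrDl; lra.
Qed.

Lemma measurable_spec_norm_gt p q (A : T -> 'M[R]_(p, q)) (y : R) : 0 <= y ->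
  (forall i j, measurable_fun setT (fun w => A w i j)) ->
  measurable [set w | y < spec_norm (A w)].
Proof.
move=> y0 mA.
pose F k := if unpickle k is Some v then
  [set w | y * vnorm (map_mx ratr v) < vnorm (A w *m map_mx ratr (v : 'cV[rat]_q))]
  else set0.
have -> : [set w | y < spec_norm (A w)] = \bigcup_k F k.
  apply/seteqP; split=> w /=.
    by move=> /(spec_norm_gtP _ _ _ _ y0)[v yv]; exists (pickle v); rewrite // /F pickleK.
  move=> [k _]; rewrite /F; case: unpickle => // v yv.
  by apply/(spec_norm_gtP _ _ _ _ y0); exists v.
apply: bigcupT_measurable => k; rewrite /F; case: unpickle => // v.
rewrite -[X in measurable X]setTI.
apply: measurable_fun_ltr => //.
apply: measurable_vnorm => j; under eq_fun do rewrite mxE.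
by apply: measurable_sum => i; apply: measurable_funM.
Qed.

End Measurability.

Definition sqnorm {R : realType} {p : nat} (v : 'cV[R]_p) : R :=
  \sum_(j < p) v j ord0 ^+ 2.

Definition dot {R : realType} {p : nat} (u v : 'cV[R]_p) : R :=
  \sum_(j < p) u j ord0 * v j ord0.

(** * Gram matrices *)

Section Deterministic.
Context {R : realType}.

Lemma sqnorm_ge0 p (v : 'cV[R]_p) : 0 <= sqnorm v.
Proof. by apply: sumr_ge0 => j _; exact: sqr_ge0. Qed.

Lemma dotvv p (v : 'cV[R]_p) : dot v v = sqnorm v.
Proof. by apply: eq_bigr => j _; rewrite expr2. Qed.

Lemma mulmx_tr_dot p (u v : 'cV[R]_p) : (u^T *m v) 0 0 = dot u v.
Proof.
rewrite mxE; apply: eq_bigr => j _; rewrite mxE.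
by congr (u j _ * v j _); exact: val_inj.
Qed.

Lemma sqnorm_sqr p (v : 'cV[R]_p) :
  sqnorm v ^+ 2 = \sum_(j < p) \sum_(k < p) (v j ord0 * v k ord0) ^+ 2.
Proof.
rewrite expr2 /sqnorm mulr_suml; apply: eq_bigr => j _.
by rewrite mulr_sumr; apply: eq_bigr => k _; rewrite exprMn.
Qed.

(** Here [K] stands for [n M]. The sum of fourth powers dominates its largest term, so each diagonal
    Gram entry is at most [sqrt (eta K)], and so is the off-diagonal norm. The numerator is thus at
    most [2 sqrt (eta K)], while the diagonal alone makes the denominator at least
    [sqrt (K / 2)]. *)
Lemma spec_norm_normalized_gram n p (x : 'I_n -> 'cV[R]_p) (eta K : R)
    (A := \sum_(i < n) (x i *m (x i)^T)) :
  0 < eta -> 0 < K ->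
  \sum_(i < n) sqnorm (x i) ^+ 4 <= (eta * K) ^+ 2 ->
  \sum_(i < n) \sum_(k < n | k != i) dot (x i) (x k) ^+ 2 <= eta * K ->
  K / 2 <= \sum_(i < n) sqnorm (x i) ^+ 2 ->
  spec_norm ((Num.sqrt (frob2 A))^-1 *: A) <= Num.sqrt (8 * eta).
Proof.
move=> eta0 K0 diag4 off diag2.
have etaK : 0 <= eta * K by rewrite mulr_ge0 ?ltW.
pose b := Num.sqrt (eta * K).
have b0 : 0 <= b by exact: sqrtr_ge0.
have b2 : b ^+ 2 = eta * K by rewrite sqr_sqrtr.
have Ab : spec_norm A <= b + b.
  apply: spec_norm_gram_diag => //; last by rewrite b2.
  move=> i; rewrite [X in X <= _]dotvv.
  rewrite -(@ler_pXn2r _ 2)// ?nnegrE ?sqnorm_ge0// b2.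
  rewrite -(@ler_pXn2r _ 2)// ?nnegrE ?sqr_ge0// -exprM.
  apply: le_trans diag4; rewrite (bigD1 i)//= lerDl.
  by apply: sumr_ge0 => k _; rewrite exprn_ge0 ?sqnorm_ge0.
have AK : K / 2 <= frob2 A.
  rewrite frob2_gram (le_trans diag2)//; apply: ler_sum => i _.
  rewrite (bigD1 i)//= [X in X ^+ 2 + _]dotvv lerDl.
  by apply: sumr_ge0 => k _; exact: sqr_ge0.
have A0 : 0 < frob2 A by rewrite (lt_le_trans _ AK)// divr_gt0.
have sA0 : 0 < Num.sqrt (frob2 A) by rewrite sqrtr_gt0.
rewrite spec_normZ ger0_norm ?invr_ge0 ?(ltW sA0)// ler_pdivrMl//.
rewrite (le_trans Ab)// -(@ler_pXn2r _ 2)// ?nnegrE ?addr_ge0 ?mulr_ge0 ?sqrtr_ge0//.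
rewrite exprMn (sqr_sqrtr (ltW A0)) sqr_sqrtr ?mulr_ge0 ?(ltW eta0)//.
have -> : (b + b) ^+ 2 = K / 2 * (8 * eta).
  by transitivity (4 * b ^+ 2); [ring|rewrite b2; field].
by rewrite ler_wpM2r// mulr_ge0 ?ltW.
Qed.

(** Normalising is invariant under positive scaling, so the factor [n^-1] cancels and the Gram
    bounds apply to [A] itself. *)
Lemma normalized_sample_cov (T : Type) (n p : nat) (X : nat -> T -> 'cV[R]_p) w
    (A := \sum_(i < n) (X i w *m (X i w)^T)) : (0 < n)%N ->
  (fnorm (sample_cov n X w))^-1 *: sample_cov n X w =
  (Num.sqrt (frob2 A))^-1 *: A.
Proof.
move=> n0; rewrite fnorm_sym ?sample_cov_sym// /sample_cov -/A frob2Z.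
rewrite sqrtrM ?sqr_ge0// sqrtr_sqr ger0_norm ?invr_ge0//.
by rewrite scalerA invfM invrK mulrAC mulfV ?mul1r// pnatr_eq0 -lt0n.
Qed.

End Deterministic.

(** * Moment bounds at a fixed sample size *)

Section FixedSampleSize.
Context {R : realType} {d : measure_display} {T : measurableType d}
  (P : probability T R) (n p : nat) (X : nat -> T -> 'cV[R]_p)
  (Sigma : 'M[R]_p).
Hypothesis iidX : iid_mean0_cov P n X Sigma.
Hypothesis n_gt0 : (0 < n)%N.
Hypothesis Sigma_neq0 : Sigma != 0.

Local Notation L1 f := (P.-integrable [set: T] (EFin \o f)).
Local Notation S := (sample_cov n X).
Local Notation Diff w :=
  ((fnorm (S w))^-1 *: S w - (fnorm Sigma)^-1 *: Sigma).

Let X_measurable i (j : 'I_p) : (i < n)%N -> measurable_fun setT (fun w => X i w j ord0).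
Proof. by move=> iltn; have [mX _] := iidX; exact: mX. Qed.

Lemma L1_coordM i (j k : 'I_p) : (i < n)%N ->
  L1 (fun w => X i w j ord0 * X i w k ord0).
Proof.
move=> iltn; have [mX [X2 _]] := iidX.
by apply: L1_mul; [exact: mX|exact: mX|exact: X2|exact: X2].
Qed.

Lemma expectation_coordM i (j k : 'I_p) : (i < n)%N ->
  \int[P]_w (X i w j ord0 * X i w k ord0) = Sigma j k.
Proof.
move=> iltn; have [_ [_ [_ [covX _]]]] := iidX.
by have := covX i j k iltn; rewrite unlock /Rintegral => ->.
Qed.

(** The entries are mixed moments of [X 0], which belongs to the sample because [n] is positive. *)
Lemma Sigma_sym : Sigma^T = Sigma.
Proof.
apply/matrixP => j k; rewrite mxE -!(expectation_coordM 0)//.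
by apply: eq_Rintegral => w _; rewrite mulrC.
Qed.

Lemma fnorm_Sigma_sqr : fnorm Sigma ^+ 2 = frob2 Sigma.
Proof. by rewrite fnorm_sym ?Sigma_sym// sqr_sqrtr// frob2_ge0. Qed.

Lemma frob2_Sigma_gt0 : 0 < frob2 Sigma.
Proof.
rewrite lt_neqAle frob2_ge0 andbT eq_sym.
by apply: contra_neq Sigma_neq0; exact: frob2_eq0.
Qed.

Lemma fnorm_Sigma_gt0 : 0 < fnorm Sigma.
Proof. by rewrite fnorm_sym ?Sigma_sym// sqrtr_gt0 frob2_Sigma_gt0. Qed.

Lemma measurable_coordM (j k : 'I_p) :
  measurable_fun setT (fun v : vec R p => (v : 'cV[R]_p) j ord0 * (v : 'cV[R]_p) k ord0).
Proof. by apply: measurable_funM; exact: measurable_coord. Qed.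

Lemma measurable_sqnorm :
  measurable_fun setT (fun v : vec R p => sqnorm (v : 'cV[R]_p)).
Proof.
by apply: measurable_sum => j; apply: measurable_funX; exact: measurable_coord.
Qed.

Lemma measurable_sqnorm_X i : (i < n)%N ->
  measurable_fun setT (fun w => sqnorm (X i w)).
Proof.
by move=> iltn; apply: measurable_sum => j; apply: measurable_funX; exact: X_measurable.
Qed.

Lemma measurable_sample_cov j k : measurable_fun setT (fun w => S w j k).
Proof.
under eq_fun do rewrite sample_covE.
apply: measurable_funM => //; apply: measurable_sum => i.
by apply: measurable_funM; exact: X_measurable.
Qed.

Lemma measurable_normalized_sample_cov j k :
  measurable_fun setT (fun w => ((fnorm (S w))^-1 *: S w) j k).
Proof.
under eq_fun do rewrite mxE.
apply: measurable_funM; last exact: measurable_sample_cov.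
apply: measurable_fun_inv => [w|]; first exact: sqrtr_ge0.
apply: (@measurableT_comp _ _ _ _ _ _ (@Num.sqrt R) setT
  (fun w => \tr (S w *m S w))).
  exact: continuous_measurable_fun (@sqrt_continuous R).
apply: measurable_sum => i; under eq_fun do rewrite mxE.
by apply: measurable_sum => l; apply: measurable_funM; exact: measurable_sample_cov.
Qed.

Lemma measurable_Diff j k : measurable_fun setT (fun w => (Diff w) j k).
Proof.
under eq_fun do rewrite mxE [X in _ + X]mxE.
by apply: measurable_funB => //; exact: measurable_normalized_sample_cov.
Qed.

(** Each entry contributes at most the second moment of a coordinate product, divided by [n]; over
    all [j] and [k] the squared products add up to [sqnorm (X 0 w) ^+ 2]. *)
Lemma expectation_frob2_sample_covB (M := \int[P]_w (sqnorm (X 0 w) ^+ 2)) :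
  L1 (fun w => sqnorm (X 0 w) ^+ 2) ->
  L1 (fun w => frob2 (S w - Sigma)) /\
  \int[P]_w frob2 (S w - Sigma) <= M / n%:R.
Proof.
move=> q2.
have n0 : n%:R != 0 :> R by rewrite pnatr_eq0 -lt0n.
have V j k : L1 (fun w => (X 0 w j ord0 * X 0 w k ord0) ^+ 2).
  apply: L1_le q2.
    by apply: measurable_funX; apply: measurable_funM; exact: X_measurable.
  move=> w; rewrite ger0_norm ?sqr_ge0// sqnorm_sqr.
  rewrite (bigD1 j)//= (bigD1 k)//= -addrA lerDl addr_ge0//.
    by apply: sumr_ge0 => l _; exact: sqr_ge0.
  by apply: sumr_ge0 => l _; apply: sumr_ge0 => m _; exact: sqr_ge0.
pose D j k w := \sum_(i < n) (X i w j ord0 * X i w k ord0 - Sigma j k).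
have VD j k : L1 (fun w => D j k w ^+ 2) /\
    \int[P]_w (D j k w ^+ 2) <= n%:R * \int[P]_w ((X 0 w j ord0 * X 0 w k ord0) ^+ 2).
  have := variance_sum_X P n p X Sigma iidX _ n_gt0 (measurable_coordM j k) (V j k).
  by rewrite /= expectation_coordM.
have SD w j k : (S w - Sigma) j k ^+ 2 = n%:R ^- 2 * D j k w ^+ 2.
  rewrite -exprVn -exprMn; congr (_ ^+ 2).
  have -> : (S w - Sigma) j k = S w j k - Sigma j k by rewrite [LHS]mxE [X in _ + X]mxE.
  rewrite sample_covE /D sumrB sumr_const card_ord -[Sigma j k *+ n]mulr_natl.
  by field.
have LD j k : L1 (fun w => (S w - Sigma) j k ^+ 2).
  by under eq_fun do rewrite SD; apply: L1Z; have [] := VD j k.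
split; first by apply: L1_sum => j; apply: L1_sum => k; exact: LD.
rewrite Rintegral_sum; last by move=> j; apply: L1_sum => k; exact: LD.
have -> : M / n%:R = \sum_(j < p) \sum_(k < p)
    n%:R^-1 * \int[P]_w ((X 0 w j ord0 * X 0 w k ord0) ^+ 2).
  rewrite /M; under eq_Rintegral do rewrite sqnorm_sqr.
  rewrite Rintegral_sum; last by move=> j; apply: L1_sum => k; exact: V.
  rewrite mulr_suml; apply: eq_bigr => j _.
  rewrite Rintegral_sum; last by move=> k; exact: V.
  by rewrite mulr_suml; apply: eq_bigr => k _; rewrite mulrC.
apply: ler_sum => j _; rewrite Rintegral_sum; last by move=> k; exact: LD.
apply: ler_sum => k _; under eq_Rintegral do rewrite SD.
have [LDjk Ejk] := VD j k; rewrite RintegralZl//.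
have -> : n%:R^-1 * \int[P]_w ((X 0 w j ord0 * X 0 w k ord0) ^+ 2) =
    n%:R ^- 2 * (n%:R * \int[P]_w ((X 0 w j ord0 * X 0 w k ord0) ^+ 2)).
  by field.
by rewrite ler_wpM2l// invr_ge0 sqr_ge0.
Qed.

Lemma expectation_frob2_Diff (M := \int[P]_w (sqnorm (X 0 w) ^+ 2)) :
  L1 (fun w => sqnorm (X 0 w) ^+ 2) ->
  L1 (fun w => frob2 (Diff w)) /\
  \int[P]_w frob2 (Diff w) <= 4 / fnorm Sigma ^+ 2 * (M / n%:R).
Proof.
move=> q2; have [LS ES] := expectation_frob2_sample_covB q2.
have LSZ : L1 (fun w => 4 / frob2 Sigma * frob2 (S w - Sigma)) by exact: L1Z.
have le_Diff w : frob2 (Diff w) <= 4 / frob2 Sigma * frob2 (S w - Sigma).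
  by rewrite !fnorm_sym ?sample_cov_sym ?Sigma_sym//; exact: frob2_normalizedB.
have LD : L1 (fun w => frob2 (Diff w)).
  apply: L1_le LSZ; first by apply: measurable_frob2; exact: measurable_Diff.
  by move=> w; rewrite ger0_norm ?frob2_ge0.
split=> //; rewrite fnorm_Sigma_sqr.
apply: (@le_trans _ _ (\int[P]_w (4 / frob2 Sigma * frob2 (S w - Sigma)))).
  exact: le_Rintegral.
by rewrite RintegralZl// ler_wpM2l// divr_ge0// ltW// frob2_Sigma_gt0.
Qed.

(** The Frobenius norm dominates the spectral norm, and Markov's inequality applies to its
    square. *)
Lemma probability_spec_norm_Diff (eps : R) (M := \int[P]_w (sqnorm (X 0 w) ^+ 2)) :
  0 < eps -> L1 (fun w => sqnorm (X 0 w) ^+ 2) ->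
  (P [set w | (eps < `|spec_norm (Diff w)|)%R] <=
   (4 / fnorm Sigma ^+ 2 * (M / n%:R) / eps ^+ 2)%:E)%E.
Proof.
move=> e0 q2; have [LD ED] := expectation_frob2_Diff q2.
have e20 : 0 < eps ^+ 2 by rewrite exprn_gt0.
have := markov_ge0 P (fun w => frob2 (Diff w)) _ e20 (fun w => frob2_ge0 _ _ (Diff w)) LD.
move=> H; apply: le_trans (le_trans _ H) _; last first.
  by rewrite lee_fin ler_wpM2r// invr_ge0 ltW.
apply: le_measure; rewrite ?inE.
- under eq_set do rewrite ger0_norm ?spec_norm_ge0//.
  by apply: measurable_spec_norm_gt; [exact: ltW|exact: measurable_Diff].
- rewrite -[X in measurable X]setTI; apply: measurable_fun_ler => //.
  by apply: measurable_frob2; exact: measurable_Diff.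
- move=> w /=; rewrite ger0_norm ?spec_norm_ge0// => ew.
  have := lt_le_trans ew (spec_norm_frob _ _ (Diff w)) => /ltW.
  rewrite -(@ler_pXn2r _ 2)// ?nnegrE ?(ltW e0) ?sqrtr_ge0//.
  by rewrite sqr_sqrtr ?frob2_ge0.
Qed.

End FixedSampleSize.

(** * Moments of the Gram entries and the tail of the normalised sample covariance *)

Section FixedSampleSize2.
Context {R : realType} {d : measure_display} {T : measurableType d}
  (P : probability T R) (n p : nat) (X : nat -> T -> 'cV[R]_p)
  (Sigma : 'M[R]_p).
Hypothesis iidX : iid_mean0_cov P n X Sigma.
Hypothesis n_gt0 : (0 < n)%N.

Local Notation L1 f := (P.-integrable [set: T] (EFin \o f)).
Local Notation S := (sample_cov n X).

Lemma expectation_sqnorm :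
  L1 (fun w => sqnorm (X 0 w)) /\ \int[P]_w sqnorm (X 0 w) = \tr Sigma.
Proof.
have LX j : L1 (fun w => X 0 w j ord0 ^+ 2).
  by have [_ [X2 _]] := iidX; exact: X2.
split; first exact: L1_sum.
rewrite Rintegral_sum//; apply: eq_bigr => j _.
by under eq_Rintegral do rewrite expr2; rewrite (expectation_coordM P n p X Sigma iidX).
Qed.

(** The variance of [sqnorm (X 0 w)], whose mean is the trace, is nonnegative. *)
Lemma sqr_tr_Sigma_le : L1 (fun w => sqnorm (X 0 w) ^+ 2) ->
  \tr Sigma ^+ 2 <= \int[P]_w (sqnorm (X 0 w) ^+ 2).
Proof.
move=> q2; have [q1 Eq] := expectation_sqnorm.
set t := \tr Sigma.
have E w : (sqnorm (X 0 w) - t) ^+ 2 =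
    sqnorm (X 0 w) ^+ 2 + (- (2 * t) * sqnorm (X 0 w) + t ^+ 2) by ring.
have : 0 <= \int[P]_w ((sqnorm (X 0 w) - t) ^+ 2).
  by apply: Rintegral_ge0 => w _; exact: sqr_ge0.
under eq_Rintegral do rewrite E.
have Lt : L1 (fun w => - (2 * t) * sqnorm (X 0 w)) by exact: L1Z.
rewrite RintegralD//; last by apply: L1D => //; exact: L1_cst.
rewrite RintegralD//; last exact: L1_cst.
by rewrite RintegralZl// Rintegral_cstT Eq -/t; lra.
Qed.

(** The expanded square is a sum over [j], [l] of a coordinate product of [X i] times the same one
    of [X k]; independence gives each term the mean [Sigma j l ^+ 2]. *)
Lemma expectation_dot2 i k : (i < n)%N -> (k < n)%N -> i != k ->
  L1 (fun w => dot (X i w) (X k w) ^+ 2) /\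
  \int[P]_w (dot (X i w) (X k w) ^+ 2) = frob2 Sigma.
Proof.
move=> iltn kltn ik.
pose c i j l (w : T) := X i w j ord0 * X i w l ord0.
have E w : dot (X i w) (X k w) ^+ 2 =
    \sum_(j < p) \sum_(l < p) c i j l w * c k j l w.
  rewrite expr2 /dot mulr_suml; apply: eq_bigr => j _.
  by rewrite mulr_sumr; apply: eq_bigr => l _; rewrite /c mulrACA.
have H j l := expectation_X2 P n p X Sigma iidX _ _ i k iltn kltn ik
  (measurable_coordM p j l) (measurable_coordM p j l)
  (L1_coordM P n p X Sigma iidX i j l iltn) (L1_coordM P n p X Sigma iidX k j l kltn).
have Lc j l : L1 (fun w => c i j l w * c k j l w) by have [] := H j l.
split.
  by under eq_fun do rewrite E; apply: L1_sum => j; exact: L1_sum.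
under eq_Rintegral do rewrite E.
rewrite Rintegral_sum; last by move=> j; exact: L1_sum.
apply: eq_bigr => j _; rewrite Rintegral_sum//; apply: eq_bigr => l _.
by have [_ ->] := H j l; rewrite !(expectation_coordM P n p X Sigma iidX).
Qed.

(** Union bound over the failure of the three conditions of [spec_norm_normalized_gram] with
    [K = n M]: each of the three terms is the Markov bound for one failure. The value of [eta]
    solves [sqrt (8 eta) = eps]. *)
Lemma probability_spec_norm_normalized (eps : R)
    (M := \int[P]_w (sqnorm (X 0 w) ^+ 2))
    (M4 := \int[P]_w (sqnorm (X 0 w) ^+ 4)) (eta := eps ^+ 2 / 8) :
  0 < eps -> 0 < M -> L1 (fun w => sqnorm (X 0 w) ^+ 4) ->
  (P [set w | (eps < `|spec_norm ((fnorm (S w))^-1 *: S w)|)%R] <=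
   (M4 / (n%:R * M ^+ 2) * 4 + M4 / (n%:R * M ^+ 2) / eta ^+ 2
    + n%:R * fnorm Sigma ^+ 2 / M / eta)%:E)%E.
Proof.
move=> eps0 M0 q4.
have eta0 : 0 < eta by rewrite divr_gt0// exprn_gt0.
have n0 : 0 < n%:R :> R by rewrite ltr0n.
have nM0 : 0 < n%:R * M by rewrite mulr_gt0.
have mq2 : measurable_fun setT (fun v : vec R p => sqnorm (v : 'cV[R]_p) ^+ 2).
  by apply: measurable_funX; exact: measurable_sqnorm.
have mq4 : measurable_fun setT (fun v : vec R p => sqnorm (v : 'cV[R]_p) ^+ 4).
  by apply: measurable_funX; exact: measurable_sqnorm.
have q4E w : (sqnorm (X 0 w) ^+ 2) ^+ 2 = sqnorm (X 0 w) ^+ 4 by rewrite -exprM.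
have L4 : L1 (fun w => (sqnorm (X 0 w) ^+ 2) ^+ 2) by under eq_fun do rewrite q4E.
pose D w := (\sum_(i < n) (sqnorm (X i w) ^+ 2 - M)) ^+ 2.
pose Q w := \sum_(i < n) sqnorm (X i w) ^+ 4.
pose O w := \sum_(i < n) \sum_(k < n | k != i) dot (X i w) (X k w) ^+ 2.
have [LD ED] : L1 D /\ \int[P]_w D w <= n%:R * M4.
  have [LD ED] := variance_sum_X P n p X Sigma iidX _ n_gt0 mq2 L4.
  split=> //; rewrite (le_trans ED)// ler_wpM2l ?(ltW n0)//.
  by under eq_Rintegral do rewrite q4E.
have L4i (i : 'I_n) : L1 (fun w => sqnorm (X i w) ^+ 4).
  exact: (L1_X P n p X Sigma iidX (fun v => sqnorm (v : 'cV[R]_p) ^+ 4) 0).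
have LQ : L1 Q by exact: L1_sum.
have EQ : \int[P]_w Q w = n%:R * M4.
  rewrite Rintegral_sum// -[n in RHS]card_ord mulr_natl -sumr_const.
  apply: eq_bigr => i _.
  by rewrite (expectation_X P n p X Sigma iidX
    (fun v => sqnorm (v : 'cV[R]_p) ^+ 4) i 0).
(* An indicator replaces the condition [k != i], so that the sums run over full index sets. *)
have OE w : O w = \sum_(i < n) \sum_(k < n)
    (k != i)%:R * dot (X i w) (X k w) ^+ 2.
  apply: eq_bigr => i _; rewrite big_mkcond/=; apply: eq_bigr => k _.
  by case: ifP => _; rewrite ?mul1r ?mul0r.
have LOik (i k : 'I_n) : L1 (fun w => (k != i)%:R * dot (X i w) (X k w) ^+ 2).
  have [->|ki] := eqVneq k i.
    by under eq_fun do rewrite mul0r; exact: L1_cst.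
  by apply: L1Z; have [] := expectation_dot2 i k (ltn_ord i) (ltn_ord k) ltac:(by rewrite eq_sym).
have LO : L1 O.
  by rewrite (funext OE); apply: L1_sum => i; exact: L1_sum.
have EO : \int[P]_w O w <= n%:R * (n%:R * fnorm Sigma ^+ 2).
  under eq_Rintegral do rewrite OE.
  rewrite Rintegral_sum; last by move=> i; exact: L1_sum.
  rewrite -[n in leRHS]card_ord [leRHS]mulr_natl -sumr_const.
  apply: ler_sum => i _; rewrite Rintegral_sum// mulr_natl -sumr_const.
  apply: ler_sum => k _.
  rewrite (fnorm_Sigma_sqr P n p X Sigma iidX n_gt0).
  have [->|ki] := eqVneq k i.
    by under eq_Rintegral do rewrite mul0r; rewrite Rintegral_cstT frob2_ge0.
  have [Lik Eik] := expectation_dot2 i k (ltn_ord i) (ltn_ord k) ltac:(by rewrite eq_sym).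
  by rewrite RintegralZl// mul1r Eik.
have D0 w : 0 <= D w by exact: sqr_ge0.
have Q0 w : 0 <= Q w by apply: sumr_ge0 => i _; rewrite exprn_ge0 ?sqnorm_ge0.
have O0 w : 0 <= O w.
  by apply: sumr_ge0 => i _; apply: sumr_ge0 => k _; exact: sqr_ge0.
have aD : 0 < (n%:R * M / 2) ^+ 2 by rewrite exprn_gt0// divr_gt0.
have aQ : 0 < (eta * (n%:R * M)) ^+ 2 by rewrite exprn_gt0// mulr_gt0.
have aO : 0 < eta * (n%:R * M) by rewrite mulr_gt0.
have PD := markov_ge0 P D _ aD D0 LD.
have PQ := markov_ge0 P Q _ aQ Q0 LQ.
have PO := markov_ge0 P O _ aO O0 LO.
have mge f (a : R) : L1 f -> measurable [set w | a <= f w].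
  move=> Lf; rewrite -[X in measurable X]setTI; apply: measurable_fun_ler => //.
  exact: L1_measurable Lf.
set BD := [set w | _] in PD; set BQ := [set w | _] in PQ; set BO := [set w | _] in PO.
have mBD : measurable BD by exact: mge.
have mBQ : measurable BQ by exact: mge.
have mBO : measurable BO by exact: mge.
apply: (@le_trans _ _ (P (BD `|` BQ `|` BO))).
  apply: le_measure; rewrite ?inE.
  - under eq_set do rewrite ger0_norm ?spec_norm_ge0//.
    apply: measurable_spec_norm_gt; first exact: ltW.
    exact: (measurable_normalized_sample_cov P n p X Sigma iidX).
  - by apply: measurableU => //; exact: measurableU.
  - move=> w /=; rewrite ger0_norm ?spec_norm_ge0// => eps_lt.
    apply: contrapT => /not_orP[/not_orP[/negP nD /negP nQ] /negP nO].
    move: eps_lt; apply/negP; rewrite -leNgt normalized_sample_cov//.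
    have -> : eps = Num.sqrt (8 * eta).
      by rewrite /eta mulrC divfK// sqrtr_sqr ger0_norm// ltW.
    apply: (spec_norm_normalized_gram _ _ _ _ (n%:R * M)) => //.
    + by rewrite ltW// ltNge.
    + by rewrite ltW// ltNge.
    (* A sum below [n M / 2] would deviate from its mean [n M] by at least [n M / 2], which is the
       event [BD]. *)
    + move: nD; rewrite -ltNge /D sumrB sumr_const card_ord -[M *+ n]mulr_natl.
      rewrite ltNge => nD; apply: contraT; rewrite -ltNge => h.
      case/negP: nD; move: h; move: (\sum_(i < n) _) => s h.
      by rewrite -[leRHS]sqrrN ler_pXn2r ?nnegrE//; lra.
apply: (le_trans (measureU2 _ _ _)) => //; first exact: measurableU.
apply: (le_trans (leeD (measureU2 _ mBD mBQ) (lexx _))).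
rewrite 2!EFinD.
apply: leeD; last first.
  apply: (le_trans PO); rewrite lee_fin ler_pdivrMr//.
  rewrite (le_trans EO)// le_eqVlt; apply/orP; left; apply/eqP.
  by field; rewrite !gt_eqF.
apply: leeD.
  apply: (le_trans PD); rewrite lee_fin ler_pdivrMr//.
  rewrite (le_trans ED)// le_eqVlt; apply/orP; left; apply/eqP.
  by field; rewrite !gt_eqF.
apply: (le_trans PQ); rewrite lee_fin ler_pdivrMr// EQ.
by rewrite le_eqVlt; apply/orP; left; apply/eqP; field; rewrite !gt_eqF.
Qed.

End FixedSampleSize2.

(** Recovers the moment from its root, since [x] is the [k]-th power of its [k]-th root; as [x] may
    be infinite a priori, the bound also proves it finite. *)
Lemma poweR_inv_le (R : realType) (k : nat) (x : \bar R) (b : R) : (0 < k)%N ->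
  0 <= b -> (0 <= x)%E -> (poweR x (k%:R^-1) <= b%:E)%E -> (x <= (b ^+ k)%:E)%E.
Proof.
move=> k0 b0 x0 xb.
have kn0 : k%:R != 0 :> R by rewrite pnatr_eq0 -lt0n.
rewrite -[leLHS]poweRe1// -[X in (poweR _ X <= _)%E](mulVf kn0) poweRrM.
rewrite -powR_mulrn// -poweR_EFin.
by apply: gt0_ler_poweR => //; rewrite ?in_itv/= ?leey ?andbT// poweR_ge0.
Qed.

(** * From the moment hypotheses to integrability and explicit tail bounds *)

Section Moments.
Context {R : realType} {d : measure_display} {T : measurableType d}
  (P : probability T R) (n p : nat) (X : nat -> T -> 'cV[R]_p)
  (Sigma : 'M[R]_p).
Hypothesis iidX : iid_mean0_cov P n X Sigma.
Hypothesis n_gt0 : (0 < n)%N.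
Hypothesis Sigma_neq0 : Sigma != 0.

Local Notation L1 f := (P.-integrable [set: T] (EFin \o f)).
Local Notation EXX2 :=
  ('E_P[fun w => ((((X 0 w)^T *m X 0 w) 0 0) ^+ 2)%R])%E.
Local Notation K2 := (poweR ('E_P[fun w =>
  (`|(((X 0 w)^T *m X 0 w) 0 0 - \tr Sigma) / fnorm Sigma| ^+ 4)%R])%E (4^-1)).

Lemma EXX2E : EXX2 = (\int[P]_w (sqnorm (X 0 w) ^+ 2)%:E)%E.
Proof.
by rewrite unlock; apply: eq_integral => w _; rewrite mulmx_tr_dot dotvv.
Qed.

Lemma EXX2_fin : L1 (fun w => sqnorm (X 0 w) ^+ 2) ->
  EXX2 = (\int[P]_w (sqnorm (X 0 w) ^+ 2))%:E.
Proof. by move=> q2; rewrite EXX2E integral_L1. Qed.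

(** The integrand is nonnegative, so a finite bound on the extended expectation already yields
    integrability. *)
Lemma EXX2_le (c : R) : (EXX2 <= c%:E)%E ->
  L1 (fun w => sqnorm (X 0 w) ^+ 2) /\ \int[P]_w (sqnorm (X 0 w) ^+ 2) <= c.
Proof.
rewrite EXX2E => h.
have q2 : L1 (fun w => sqnorm (X 0 w) ^+ 2).
  apply: L1_ge0; first by apply: measurable_funX; exact: (measurable_sqnorm_X P n p X Sigma iidX).
    by move=> w; exact: sqr_ge0.
  by rewrite (le_lt_trans h)// ltry.
by split=> //; move: h; rewrite integral_L1// lee_fin.
Qed.

(** Write [sqnorm (X 0 w)] as its mean plus [fnorm Sigma] times the standardised variable whose
    fourth moment [K2] controls; the fourth power of the mean is at most the square of the second
    moment. *)
Lemma K2_le (b : R) : 0 <= b -> (K2 <= b%:E)%E ->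
  [/\ L1 (fun w => sqnorm (X 0 w) ^+ 4), L1 (fun w => sqnorm (X 0 w) ^+ 2) &
    \int[P]_w (sqnorm (X 0 w) ^+ 4) <=
    8 * ((\int[P]_w (sqnorm (X 0 w) ^+ 2)) ^+ 2 + fnorm Sigma ^+ 4 * b ^+ 4)].
Proof.
move=> b0; set E := 'E_P[_]%E => Kb.
have f0 : fnorm Sigma != 0.
  by rewrite gt_eqF// (fnorm_Sigma_gt0 P n p X Sigma iidX).
have mq : measurable_fun setT (fun w => sqnorm (X 0 w)).
  exact: (measurable_sqnorm_X P n p X Sigma iidX).
pose Y w := ((sqnorm (X 0 w) - \tr Sigma) / fnorm Sigma) ^+ 4.
have Y0 w : 0 <= Y w by rewrite /Y (exprM _ 2 2) sqr_ge0.
have EE : E = (\int[P]_w (Y w)%:E)%E.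
  rewrite /E unlock; apply: eq_integral => w _; rewrite mulmx_tr_dot dotvv.
  by rewrite -normrX ger0_norm// Y0.
have Eb : (E <= (b ^+ 4)%:E)%E.
  apply: poweR_inv_le => //.
  by rewrite EE; apply: integral_ge0 => w _; rewrite lee_fin.
have mY : measurable_fun setT Y.
  by apply: measurable_funX; apply: measurable_funM => //; exact: measurable_funB.
have LY : L1 Y.
  by apply: L1_ge0 => //; rewrite -EE (le_lt_trans Eb)// ltry.
have EY : \int[P]_w Y w <= b ^+ 4 by move: Eb; rewrite EE integral_L1// lee_fin.
have q4_le w : sqnorm (X 0 w) ^+ 4 <=
    8 * (\tr Sigma ^+ 4 + fnorm Sigma ^+ 4 * Y w).
  have -> : sqnorm (X 0 w) =
      \tr Sigma + fnorm Sigma * ((sqnorm (X 0 w) - \tr Sigma) / fnorm Sigma).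
    by field.
  (* The constant 8 comes from using [(s + t)^2 <= 2 (s^2 + t^2)] twice. *)
  rewrite /Y -exprMn; move: (\tr Sigma) (fnorm Sigma * _) => s t.
  have h1 : (s + t) ^+ 2 <= 2 * (s ^+ 2 + t ^+ 2).
    by have := sqr_ge0 (s - t); nra.
  have h2 : ((s + t) ^+ 2) ^+ 2 <= (2 * (s ^+ 2 + t ^+ 2)) ^+ 2.
    by rewrite ler_pXn2r ?nnegrE ?sqr_ge0// mulr_ge0// addr_ge0// sqr_ge0.
  have h3 := sqr_ge0 (s ^+ 2 - t ^+ 2).
  by move: h2 h3; nra.
have LB : L1 (fun w => 8 * (\tr Sigma ^+ 4 + fnorm Sigma ^+ 4 * Y w)).
  by apply: L1Z; apply: L1D; [exact: L1_cst|exact: L1Z].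
have q4 : L1 (fun w => sqnorm (X 0 w) ^+ 4).
  apply: L1_le LB; first exact: measurable_funX.
  by move=> w; rewrite ger0_norm// exprn_ge0// sqnorm_ge0.
have q2 : L1 (fun w => sqnorm (X 0 w) ^+ 2).
  apply: L1_sqr; first exact: measurable_funX.
  by under eq_fun do rewrite -exprM.
split=> //.
apply: (@le_trans _ _ (8 * (\tr Sigma ^+ 4 + fnorm Sigma ^+ 4 * \int[P]_w Y w))).
  rewrite [leRHS](_ : _ = \int[P]_w (8 * (\tr Sigma ^+ 4 + fnorm Sigma ^+ 4 * Y w))).
    exact: le_Rintegral.
  rewrite RintegralZl//; last by apply: L1D; [exact: L1_cst|exact: L1Z].
  by rewrite RintegralD//; [rewrite Rintegral_cstT RintegralZl|exact: L1_cst|exact: L1Z].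
have t2 := sqr_tr_Sigma_le P n p X Sigma iidX n_gt0 q2.
rewrite ler_wpM2l// lerD//.
  by rewrite (exprM _ 2 2) ler_pXn2r ?nnegrE ?sqr_ge0// (le_trans _ t2)// sqr_ge0.
by rewrite ler_wpM2l// (exprM _ 2 2) sqr_ge0.
Qed.

(** The exponent 3/4 enters here: writing [f] for [fnorm Sigma],
    [f^4 (C n^(3/4))^4 = C^4 n (n f^2)^2], at most [C^4 n (e M)^2]. Dividing by [n M^2] leaves the
    small quantity [C^4 e^2]. *)
Lemma probability_spec_norm_le (eps e C : R)
    (K := 4 + (eps ^+ 2 / 8) ^- 2) :
  0 < eps -> 0 < e -> 0 < C ->
  (K2 <= (C * powR n%:R (3 / 4))%:E)%E ->
  ((n%:R * fnorm Sigma ^+ 2)%:E <= e%:E * EXX2)%E ->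
  (P [set w | (eps < `|spec_norm ((fnorm (sample_cov n X w))^-1 *:
     sample_cov n X w)|)%R] <=
   ((8 / n%:R + 8 * C ^+ 4 * e ^+ 2) * K + e / (eps ^+ 2 / 8))%:E)%E.
Proof.
move=> eps0 e0 C0 hK he.
have n0 : 0 < n%:R :> R by rewrite ltr0n.
have [q4 q2 M4le] := K2_le _ (mulr_ge0 (ltW C0) (powR_ge0 _ _)) hK.
move: he; rewrite EXX2_fin// lee_fin.
move: M4le; set M := \int[P]_w (sqnorm (X 0 w) ^+ 2); set M4 := \int[P]_w _ => M4le fM.
have f0 : 0 < fnorm Sigma by exact: (fnorm_Sigma_gt0 P n p X Sigma iidX).
(* Positivity is forced by [n f^2 <= e M], where [f > 0]. *)
have M0 : 0 < M.
  by rewrite -(pmulr_rgt0 _ e0) (lt_le_trans _ fM)// mulr_gt0// exprn_gt0.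
have nK : powR n%:R (3 / 4) ^+ 4 = n%:R ^+ 3 :> R.
  by rewrite -powR_mulrn ?powR_ge0// -powRrM divfK// powR_mulrn.
have M4r : M4 / (n%:R * M ^+ 2) <= 8 / n%:R + 8 * C ^+ 4 * e ^+ 2.
  rewrite ler_pdivrMr; last by rewrite mulr_gt0// exprn_gt0.
  rewrite (le_trans M4le)// exprMn nK.
  have -> : (8 / n%:R + 8 * C ^+ 4 * e ^+ 2) * (n%:R * M ^+ 2) =
      8 * (M ^+ 2 + n%:R * C ^+ 4 * (e * M) ^+ 2) by field; rewrite gt_eqF.
  have -> : fnorm Sigma ^+ 4 * (C ^+ 4 * n%:R ^+ 3) =
      n%:R * C ^+ 4 * (n%:R * fnorm Sigma ^+ 2) ^+ 2 by ring.
  rewrite ler_wpM2l// lerD2l ler_wpM2l ?mulr_ge0 ?exprn_ge0 ?(ltW C0)//.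
  have nf0 : 0 <= n%:R * fnorm Sigma ^+ 2 by apply: mulr_ge0; [exact: ltW|exact: sqr_ge0].
  have eM0 : 0 <= e * M by apply: mulr_ge0; exact: ltW.
  by rewrite ler_pXn2r ?nnegrE.
have eta0 : 0 < eps ^+ 2 / 8 by rewrite divr_gt0// exprn_gt0.
apply: (le_trans (probability_spec_norm_normalized P n p X Sigma iidX n_gt0 _ eps0 M0 q4)).
rewrite lee_fin -/M -/M4 lerD//.
  by rewrite -mulrDr ler_wpM2r// addr_ge0// invr_ge0 sqr_ge0.
by rewrite ler_pM2r ?invr_gt0// ler_pdivrMr.
Qed.

End Moments.

(** * Passage from the bounds at each sample size to the limit *)

Theorem mainTheorem6 (R : realType) (d : measure_display)
  (T : nat -> measurableType d) (P : forall n, probability (T n) R)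
  (p : nat -> nat) (X : forall n, nat -> T n -> 'cV[R]_(p n))
  (Sigma : forall n, 'M[R]_(p n)) :
  (forall n, iid_mean0_cov (P n) n (X n) (Sigma n) /\ Sigma n != 0) ->
  let Shat := fun n (w : T n) => sample_cov n (X n) w in
  let fhat := fun n (w : T n) => fnorm (Shat n w) in
  let f := fun n => fnorm (Sigma n) in
  let Diff := fun n (w : T n) => (fhat n w)^-1 *: Shat n w - (f n)^-1 *: Sigma n in
  (* E[(X_1^T X_1)^2] *)
  let EXX2 := fun n => ('E_(P n)[fun w => ((((X n 0 w)^T *m X n 0 w) 0 0) ^+ 2)%R])%E in
  (* E[(X_1^T X_2)^4] *)
  let EX12_4 := fun n => ('E_(P n)[fun w => ((((X n 0 w)^T *m X n 1 w) 0 0) ^+ 4)%R])%E in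
  (* K_2 = (E|(X_1^T X_1 - f_1)/f|^4)^{1/4},  f_1 = tr Sigma *)
  let K2 := fun n => poweR ('E_(P n)[fun w =>
                (`|(((X n 0 w)^T *m X n 0 w) 0 0 - \tr (Sigma n)) / f n| ^+ 4)%R])%E (4^-1) in
  ((* (i) *)
   (forall eps : R, 0 < eps ->
      \forall n \near \oo, (EXX2 n <= (eps * (n%:R * f n ^+ 2))%:E)%E) ->
   (forall eps : R, 0 < eps ->
      \forall n \near \oo, ('E_(P n)[fun w => frob2 (Diff n w)] <= eps%:E)%E) /\
   o_P1 P (fun n w => spec_norm (Diff n w)))
  /\
  ((* (ii) *)
   (forall eps : R, 0 < eps ->
      \forall n \near \oo, ((n%:R * f n ^+ 2)%:E <= eps%:E * EXX2 n)%E) ->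
   (exists C : R, 0 < C /\
      \forall n \near \oo, (K2 n <= (C * powR n%:R (3 / 4))%:E)%E) ->
   (forall eps : R, 0 < eps ->
      \forall n \near \oo, (EX12_4 n <= eps%:E * (EXX2 n * EXX2 n))%E) ->
   o_P1 P (fun n w => spec_norm ((fhat n w)^-1 *: Shat n w)) /\
   (o_P1 P (fun n w => spec_norm (Diff n w)) <->
    little_o (fun n => spec_norm (Sigma n)) f)).
Proof.
move=> iid Shat fhat f Diff EXX2 EX12_4 K2.
(* At [n = 0] the model constrains no vector and [Sigma] need not be a covariance, so positivity of
   [f] is claimed for positive [n] only. *)
have f_gt0 n : (0 < n)%N -> 0 < f n.
  by move=> n0; have [iidn Sn] := iid n; exact: (fnorm_Sigma_gt0 (P n) n (p n) (X n) _ iidn).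
split.
- move=> h; split.
  + move=> eps eps0; near=> n.
    have n0 : (0 < n)%N by near: n; exact: nbhs_infty_gt.
    have [iidn Sn] := iid n; have fn0 := f_gt0 n n0.
    (* The divisor 4 absorbs the constant of [expectation_frob2_Diff]. *)
    have hn : (EXX2 n <= (eps / 4 * (n%:R * f n ^+ 2))%:E)%E.
      by near: n; apply: h; rewrite divr_gt0.
    have [q2 Mle] := EXX2_le (P n) n (p n) (X n) _ iidn n0 _ hn.
    have [LD ED] := expectation_frob2_Diff (P n) n (p n) (X n) _ iidn n0 Sn q2.
    rewrite unlock integral_L1// lee_fin (le_trans ED)//.
    rewrite -[leRHS](_ : 4 / f n ^+ 2 * ((eps / 4 * (n%:R * f n ^+ 2)) / n%:R) = _).
      by rewrite ler_wpM2l ?divr_ge0 ?sqr_ge0// ler_wpM2r.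
    by field; rewrite pnatr_eq0 -lt0n n0 gt_eqF.
  + move=> eps delta eps0 delta0; near=> n.
    have n0 : (0 < n)%N by near: n; exact: nbhs_infty_gt.
    have [iidn Sn] := iid n; have fn0 := f_gt0 n n0.
    (* The factor [eps ^+ 2] compensates the denominator in Markov's inequality. *)
    have hn : (EXX2 n <= (delta * eps ^+ 2 / 4 * (n%:R * f n ^+ 2))%:E)%E.
      by near: n; apply: h; rewrite divr_gt0// mulr_gt0// exprn_gt0.
    have [q2 Mle] := EXX2_le (P n) n (p n) (X n) _ iidn n0 _ hn.
    have := probability_spec_norm_Diff (P n) n (p n) (X n) _ iidn n0 Sn _ eps0 q2.
    move=> H; apply: (le_trans H); rewrite lee_fin.
    rewrite -[leRHS](_ : 4 / f n ^+ 2 *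
      ((delta * eps ^+ 2 / 4 * (n%:R * f n ^+ 2)) / n%:R) / eps ^+ 2 = _).
      by rewrite ler_wpM2r ?invr_ge0 ?sqr_ge0// ler_wpM2l ?divr_ge0 ?sqr_ge0// ler_wpM2r.
    by field; rewrite pnatr_eq0 -lt0n n0 !gt_eqF.
- move=> h1 [C [C0 hK]] _.
  have normalized_oP : o_P1 P (fun n w => spec_norm ((fhat n w)^-1 *: Shat n w)).
    move=> eps delta eps0 delta0.
    pose eta := eps ^+ 2 / 8.
    have eta0 : 0 < eta by rewrite divr_gt0// exprn_gt0.
    pose K := 4 + eta ^- 2.
    have K0 : 0 < K by rewrite ltr_wpDr// invr_ge0 sqr_ge0.
    pose c := 8 * C ^+ 4 * K + eta^-1.
    have c0 : 0 < c by rewrite addr_gt0 ?invr_gt0// !mulr_gt0// exprn_gt0.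
    (* The bound 1 gives [e ^+ 2 <= e], so the terms containing [e] total at most [e * c], which the
       other bound keeps below [delta / 2]. *)
    pose e := Num.min 1 (delta / 2 / c).
    have e0 : 0 < e by rewrite lt_min ltr01/= !divr_gt0.
    near=> n.
    have n0 : (0 < n)%N by near: n; exact: nbhs_infty_gt.
    have [iidn Sn] := iid n.
    have hn : ((n%:R * f n ^+ 2)%:E <= e%:E * EXX2 n)%E by near: n; exact: h1.
    have hKn : (K2 n <= (C * powR n%:R (3 / 4))%:E)%E by near: n.
    (* This makes the remaining term [8 / n * K] at most [delta / 2]. *)
    have nbig : 16 * K / delta <= n%:R by near: n; exact: nbhs_infty_ger.
    have := probability_spec_norm_le (P n) n (p n) (X n) _ iidn n0 Sn _ _ _ eps0 e0 C0 hKn hn.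
    move=> H; apply: (le_trans H); rewrite lee_fin -/eta -/K.
    have nR : 0 < n%:R :> R by rewrite ltr0n.
    have b1 : 8 / n%:R * K <= delta / 2.
      rewrite mulrAC ler_pdivrMr//.
      by move: nbig; rewrite ler_pdivrMr//; lra.
    have b2 : 8 * C ^+ 4 * e ^+ 2 * K + e / eta <= delta / 2.
      apply: (@le_trans _ _ (e * c)); last first.
        by rewrite -ler_pdivlMr// ge_min lexx orbT.
      have -> : e * c = 8 * C ^+ 4 * e * K + e / eta by rewrite /c; ring.
      rewrite lerD2r ler_wpM2r ?(ltW K0)// ler_wpM2l ?mulr_ge0 ?exprn_ge0 ?(ltW C0)//.
      by rewrite expr2 ler_piMr ?(ltW e0)// ge_min lexx.
    by rewrite mulrDl; lra.
  have measurable_gt n (A : T n -> 'M[R]_(p n)) y : 0 < y ->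
      (forall i j, measurable_fun setT (fun w => A w i j)) ->
      measurable [set w | y < `|spec_norm (A w)|].
    move=> y0 mA; under eq_set do rewrite ger0_norm ?spec_norm_ge0//.
    by apply: measurable_spec_norm_gt; [exact: ltW|].
  have measurable_S n y : (0 < n)%N -> 0 < y ->
      measurable [set w | y < `|spec_norm ((fhat n w)^-1 *: Shat n w)|].
    move=> n0 y0; apply: measurable_gt => //.
    exact: (measurable_normalized_sample_cov (P n) n (p n) (X n) _ (iid n).1).
  have measurable_D n y : (0 < n)%N -> 0 < y ->
      measurable [set w | y < `|spec_norm (Diff n w)|].
    move=> n0 y0; apply: measurable_gt => //.
    exact: (measurable_Diff (P n) n (p n) (X n) _ (iid n).1).
  split => //; split.
  + move=> oD eps eps0.
    have e20 : 0 < eps / 2 by rewrite divr_gt0.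
    have d40 : 0 < 4^-1 :> R by rewrite invr_gt0.
    near=> n.
    have n0 : (0 < n)%N by near: n; exact: nbhs_infty_gt.
    have fn0 := f_gt0 n n0.
    have P1 : (P n [set w | (eps / 2 < `|spec_norm ((fhat n w)^-1 *: Shat n w)|)%R] <=
        (4^-1)%:E)%E.
      by near: n; exact: normalized_oP.
    have P2 : (P n [set w | (eps / 2 < `|spec_norm (Diff n w)|)%R] <= (4^-1)%:E)%E.
      by near: n; exact: oD.
    rewrite ger0_norm ?spec_norm_ge0// ger0_norm ?(ltW fn0)//.
    set B1 := [set w | _] in P1; set B2 := [set w | _] in P2.
    have mB1 : measurable B1 by exact: measurable_S.
    have mB2 : measurable B2 by exact: measurable_D.
    (* The target is deterministic, so one good sample point suffices: two events of probability at
       most 1/4 cannot cover the space, and outside both the triangle inequality bounds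
       [Sigma / f]. *)
    have [w nB] : exists w, ~ (B1 `|` B2) w.
      apply: contrapT => /forallNP H.
      have B12 : B1 `|` B2 = setT.
        by apply/seteqP; split=> // w _; apply: contrapT; exact: H.
      have : (P n setT <= (4^-1)%:E + (4^-1)%:E)%E.
        by rewrite -B12; exact: le_trans (measureU2 (P n) mB1 mB2) (leeD P1 P2).
      by rewrite probability_setT -EFinD lee_fin; lra.
    move: nB => /not_orP[/negP]; rewrite -leNgt => w1 /negP; rewrite -leNgt => w2.
    have : spec_norm ((f n)^-1 *: Sigma n) <= eps.
      have -> : (f n)^-1 *: Sigma n = (fhat n w)^-1 *: Shat n w + - Diff n w.
        by rewrite /Diff opprB addrC subrK.
      rewrite (le_trans (spec_normD _ _ _ _))// spec_normN.
      rewrite (splitr eps) lerD//.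
        by rewrite (le_trans (ler_norm _)).
      by rewrite (le_trans (ler_norm _)).
    by rewrite spec_normZ ger0_norm ?invr_ge0 ?(ltW fn0)// ler_pdivrMl// mulrC.
  + move=> oS eps delta eps0 delta0.
    have e20 : 0 < eps / 2 by rewrite divr_gt0.
    near=> n.
    have n0 : (0 < n)%N by near: n; exact: nbhs_infty_gt.
    have fn0 := f_gt0 n n0.
    have Pn : (P n [set w | (eps / 2 < `|spec_norm ((fhat n w)^-1 *: Shat n w)|)%R] <=
        delta%:E)%E.
      by near: n; exact: normalized_oP.
    (* Once [Sigma / f] has spectral norm at most [eps / 2], a difference above [eps] forces the
       normalised sample covariance above [eps / 2]. *)
    have sn : `|spec_norm (Sigma n)| <= eps / 2 * `|f n| by near: n; exact: oS.
    apply: le_trans Pn; apply: le_measure; rewrite ?inE.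
    * exact: measurable_D.
    * exact: measurable_S.
    * move=> w /=; rewrite !ger0_norm ?spec_norm_ge0// => ew.
      have : spec_norm (Diff n w) <=
          spec_norm ((fhat n w)^-1 *: Shat n w) + spec_norm ((f n)^-1 *: Sigma n).
        by rewrite (le_trans (spec_normD _ _ _ _))// spec_normN.
      have : spec_norm ((f n)^-1 *: Sigma n) <= eps / 2.
        rewrite spec_normZ ger0_norm ?invr_ge0 ?(ltW fn0)// ler_pdivrMl// mulrC.
        by move: sn; rewrite ger0_norm ?spec_norm_ge0// ger0_norm// ltW.
      by lra.
Unshelve. all: by end_near.
Qed.
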